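(* Let $X$ be a complex Banach space, let $1<\alpha<2$, and let $k\in L^1(\mathbb{R}^+)$ be scalar-valued. Assume: (1) $A:D(A)\subset X\to X$ is a densely defined linear operator that is sectorial of type $\omega<0$ and angle $\theta\in[0,\pi(1-\frac{\alpha}{2}))$ with constant $M>0$. (2) $f\in AAA(\mathbb{R}\times X\times X,X)$, and there is a constant $L_f>0$ such that $\|f(t,u,\phi)-f(t,v,\psi)\|\le L_f(\|u-v\|+\|\phi-\psi\|)$ for all $(t,u,\phi),(t,v,\psi)\in\mathbb{R}\times X\times X$. (3) The associated family $\{S_\alpha(t)\}_{t\ge 0}$ of bounded linear operators on $X$ is strongly continuous. Let $C>0$ be a constant such that $\|S_\alpha(t)\|\le \frac{CM}{1+|\omega|t^\alpha}$ for all $t\ge 0$. If $$\Lambda=\frac{CM|\omega|^{-\frac{1}{\alpha}}\pi}{\alpha\sin(\frac{\pi}{\alpha})}\,L_f\,\bigl(1+\|k\|_{L^1(\mathbb{R}^+)}\bigr)<1,$$ then there exists a unique asymptotically almost automorphic mild solution $u\in AAA(\mathbb{R},X)$ of the equation $${}^{C}D_t^{\alpha}u(t)=Au(t)+{}^{C}D_t^{\alpha-1}f(t,u(t),Ku(t)),\qquad Ku(t)=\int_{-\infty}^t k(t-s)u(s)\,ds,\qquad u(0)+g(u)=u_0,\qquad t\in\mathbb{R},$$ where $u_0\in X$, $g$ is the function giving the nonlocal condition, and mild solutions are understood in the sense given in the context. That is, there is exactly one $u\in AAA(\mathbb{R},X)$ such that for each $t\in\mathbb{R}$ the function $s\mapsto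 S_\alpha(t-s)f(s,u(s),Ku(s))$ is integrable on $(-\infty,t)$ and $$u(t)=\int_{-\infty}^t S_\alpha(t-s)f(s,u(s),Ku(s))\,ds .$$
   Context: Notation: $\mathbb{R}^+=[0,\infty)$. For $n-1<\beta<n$ with $n$ a positive integer, ${}^{C}D_t^{\beta}\varphi(t)=\frac{1}{\Gamma(n-\beta)}\int_0^t(t-s)^{n-\beta-1}\varphi^{(n)}(s)\,ds$ is the Caputo derivative (it motivates the equation; the notion of solution used is the mild one below). Sectorial operator: a closed linear operator $A$ on $X$ is sectorial of type $\omega\in\mathbb{R}$ and angle $\theta$ with constant $M>0$ if its resolvent exists outside the sector $\omega+S_\theta:=\{\omega+\lambda:\lambda\in\mathbb{C},\ |\arg(-\lambda)|<\theta\}$ and $\|(\lambda-A)^{-1}\|\le\frac{M}{|\lambda-\omega|}$ for $\lambda\notin\omega+S_\theta$. The family $S_\alpha$: for $A$ sectorial of type $\omega<0$ and angle $\theta\in[0,\pi(1-\frac{\alpha}{2}))$, $$S_\alpha(t)=\frac{1}{2\pi i}\int_\gamma e^{\lambda t}\lambda^{\alpha-1}(\lambda^\alpha I-A)^{-1}\,d\lambda,\qquad t\ge 0,$$ where $\gamma$ is a suitable (inverse Laplace transform, Hankel-type) path such that $\lambda^\alpha$ lies outside the sector $\omega+S_\theta$ for $\lambda\in\gamma$. It is a known result (Cuesta) that there exists $C>0$ with $\|S_\alpha(t)\|\le\frac{CM}{1+|\omega|t^\alpha}$ for all $t\ge0$; also $\int_0^\infty\frac{dt}{1+|\omega|t^\alpha}=\frac{|\omega|^{-1/\alpha}\pi}{\alpha\sin(\pi/\alpha)}$.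 Almost automorphic functions: a bounded continuous $\varphi:\mathbb{R}\to X$ is almost automorphic, $\varphi\in AA(\mathbb{R},X)$, if every real sequence $(s_n)$ has a subsequence $(s_{n_k})$ such that $\psi(t)=\lim_{k\to\infty}\varphi(t+s_{n_k})$ is well defined for each $t\in\mathbb{R}$ and $\lim_{k\to\infty}\psi(t-s_{n_k})=\varphi(t)$ for each $t\in\mathbb{R}$. For a Banach space $Y$ (here $Y=X\times X$), a bounded continuous $\varphi:\mathbb{R}\times Y\to X$ belongs to $AA(\mathbb{R}\times Y,X)$ if for every compact $Q\subset Y$ and every real sequence $(s_n)$ there is a subsequence $(s_{n_k})$ such that $\psi(t,y)=\lim_{k\to\infty}\varphi(t+s_{n_k},y)$ is well defined and $\lim_{k\to\infty}\psi(t-s_{n_k},y)=\varphi(t,y)$ for each $t\in\mathbb{R}$, $y\in Q$. Vanishing functions: $\mathcal{C}_0(\mathbb{R},X)$ is the space of bounded continuous $h:\mathbb{R}\to X$ with $\|h(t)\|\to0$ as $t\to\infty$ (i.e. $t\to+\infty$); $\mathcal{C}_0(\mathbb{R}\times Y,X)$ is the space of bounded continuous $h:\mathbb{R}\times Y\to X$ with $\lim_{t\to\infty}\|h(t,y)\|=0$ uniformly for $y$ in any bounded subset of $Y$. Asymptotically almost automorphic functions: $AAA(\mathbb{R},X)$ is the set of bounded continuous functions of the form $f_1+f_2$ with $f_1\in AA(\mathbb{R},X)$, $f_2\in\mathcal{C}_0(\mathbb{R},X)$. $AAA(\mathbb{R}\times Y,X)$ is the set of bounded continuous functions of the form $f_1+f_2$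 with $f_1\in AA(\mathbb{R}\times Y,X)$, $f_2\in\mathcal{C}_0(\mathbb{R}\times Y,X)$. Mild solution: a function $u:\mathbb{R}\to X$ is a mild solution of the equation if for each $t\in\mathbb{R}$ the function $s\mapsto S_\alpha(t-s)f(s,u(s),Ku(s))$ is integrable on $(-\infty,t)$ and $u(t)=\int_{-\infty}^tS_\alpha(t-s)f(s,u(s),Ku(s))\,ds$. (The initial/nonlocal data $u_0,g$ do not enter this definition.) *)

(* Defs.v *)
From HB Require Import structures.
From mathcomp Require Import all_boot all_order all_algebra.
From mathcomp Require Import complex.
From mathcomp Require Import all_classical all_reals all_analysis.

Set Implicit Arguments.
Unset Strict Implicit.
Unset Printing Implicit Defensive.

Import Order.TTheory GRing.Theory Num.Theory.
Import numFieldNormedType.Exports.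

Local Open Scope classical_set_scope.
Local Open Scope ring_scope.
Local Open Scope complex_scope.

(* A complex Banach space is a [completeNormedModType R[i]].  Its norm takes
   values in R[i]; these are real and nonnegative, and [nrm] reads them in R. *)
Definition nrm {R : realType} {V : normedZmodType R[i]} (x : V) : R :=
  complex.Re `|x|.

Section Bochner.
Context {R : realType} {X : normedModType R[i]}.

Local Notation mu := (@lebesgue_measure R).

(* A list (A_i, x_i) stands for the simple function sum_i 1_{A_i} x_i. *)
Definition step_fun (s : seq (set R * X)) (t : R) : X :=
  \sum_(p <- s) (\1_(p.1) t : R)%:C *: p.2.

Definition simple_on (D : set R) (s : seq (set R * X)) : Prop :=
  forall p, p \in s ->
    (measurable (p.1 : set (measurableTypeR R))
     /\ mu (D `&` p.1) < +oo)%E.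

Definition step_int (D : set R) (s : seq (set R * X)) : X :=
  \sum_(p <- s) (fine (mu (D `&` p.1)))%:C *: p.2.

(* Pointwise a.e. convergence is strong measurability of g on D.  It also makes
   the integral below the true Lebesgue integral: for a possibly non-Borel
   integrand that is a.e. equal to a Borel one, the supremum over Borel simple
   minorants used by the library has the expected value. *)
Definition is_bochner (D : set R) (g : R -> X) (v : X) : Prop :=
  exists s : nat -> seq (set R * X),
    [/\ forall n, simple_on D (s n),
        {ae mu, forall t, D t -> step_fun (s n) t @[n --> \oo] --> g t},
        (\int[mu]_(t in D) (nrm (g t - step_fun (s n) t))%:E)%E
          @[n --> \oo] --> 0%E
      & step_int D (s n) @[n --> \oo] --> v].

Definition bochner_integrable (D : set R) (g : R -> X) : Prop :=
  exists v, is_bochner D g v.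

Definition bochner_int (D : set R) (g : R -> X) : X :=
  xget 0 [set v | is_bochner D g v].

End Bochner.

Section ScalarKernel.
Context {R : realType}.

Definition L1_Rplus (k : R -> R[i]) : Prop :=
  bochner_integrable `[0, +oo[ (k : R -> R[i]^o).

Definition L1_norm (k : R -> R[i]) : R :=
  fine (\int[lebesgue_measure]_(r in `[0%R, +oo[) (nrm (k r))%:E)%E.

End ScalarKernel.

Section ComplexFunctions.
Context {R : realType}.

Definition cexp (z : R[i]) : R[i] :=
  (expR (complex.Re z))%:C * (cos (complex.Im z) +i* sin (complex.Im z)).

Definition cis (psi : R) : R[i] := cexp (0 +i* psi).

(* Principal argument, in ]-pi, pi]; meaningless at 0. *)
Definition carg (z : R[i]) : R :=
  if 0 <= complex.Im z then acos (complex.Re z / nrm z)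
  else - acos (complex.Re z / nrm z).

(* Principal branch of z ^ a for z <> 0. *)
Definition cpow (z : R[i]) (a : R) : R[i] :=
  cexp (a%:C * (ln (nrm z) +i* carg z)).

(* omega + S_theta.  The vertex omega, where arg is undefined and where the
   bound M / |lambda - omega| is meaningless, is counted in the sector. *)
Definition sector (omega theta : R) : set R[i] :=
  [set z | z = omega%:C \/ `|carg (omega%:C - z)| < theta].

End ComplexFunctions.

Section Operators.
Context {R : realType} {X : completeNormedModType R[i]}.

(* An unbounded operator is a domain D together with a function A : X -> X
   whose values outside D are irrelevant. *)
Definition linear_op (D : set X) (A : X -> X) : Prop :=
  D 0 /\ forall (a : R[i]) x y, D x -> D y ->
           D (a *: x + y) /\ A (a *: x + y) = a *: A x + A y.

Definition closed_op (D : set X) (A : X -> X) : Prop :=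
  closed [set p : X * X | D p.1 /\ p.2 = A p.1].

Definition resolvent (D : set X) (A : X -> X) (z : R[i]) (y : X) : X :=
  xget 0 [set x | D x /\ z *: x - A x = y].

(* Boundedness of the resolvent is the norm estimate. *)
Definition sectorial (D : set X) (A : X -> X) (omega theta M : R) : Prop :=
  [/\ linear_op D A,
      closed_op D A
    & forall z : R[i], ~ sector omega theta z ->
        (forall y, exists! x, D x /\ z *: x - A x = y)
        /\ forall y, nrm (resolvent D A z y)
                     <= M / nrm (z - omega%:C) * nrm y].

(* The Hankel path runs from infinity along arg = -phi to the circle of radius
   eps, along this circle to arg = phi, and back to infinity along arg = phi. *)
Definition hankel_int (eps phi : R) (G : R[i] -> X) : X :=
  bochner_int `[eps, +oo[ (fun r => cis phi *: G (r%:C * cis phi))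
  - bochner_int `[eps, +oo[ (fun r => cis (- phi) *: G (r%:C * cis (- phi)))
  + bochner_int `[- phi, phi]
      (fun psi => ('i * eps%:C * cis psi) *: G (eps%:C * cis psi)).

(* lambda ^ alpha avoids the sector on the path, and also to the right of it:
   this is what makes the contour integral an inverse Laplace transform. *)
Definition hankel_path (alpha omega theta eps phi : R) : Prop :=
  [/\ 0 < eps, pi / 2 < phi, phi < pi
    & forall z : R[i], eps <= nrm z -> `|carg z| <= phi ->
        ~ sector omega theta (cpow z alpha)].

(* At t = 0 the contour integral is not absolutely convergent; S_alpha(0) is
   the identity, the strong limit of S_alpha(t) as t -> 0+. *)
Definition S_alpha (alpha : R) (D : set X) (A : X -> X) (eps phi : R)
    (t : R) (x : X) : X :=
  if t == 0 then x
  else (2 * pi%:C * 'i)^-1 *: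
    hankel_int eps phi (fun z =>
      (cexp (t%:C * z) * cpow z (alpha - 1)) *: resolvent D A (cpow z alpha) x).

Definition strongly_continuous_family (S : R -> X -> X) : Prop :=
  (forall t, 0 <= t -> linear (S t) /\ continuous (S t))
  /\ forall x, {within `[0, +oo[, continuous (fun t => S t x)}.

End Operators.

Section AlmostAutomorphic.
Context {R : realType} {X : normedModType R[i]}.

Definition bounded_continuous (T : topologicalType) (h : T -> X) : Prop :=
  continuous h /\ exists c : R, forall t, nrm (h t) <= c.

Definition AA (h : R -> X) : Prop :=
  bounded_continuous h /\
  forall s : nat -> R, exists e : nat -> nat, {homo e : m n / (m < n)%N} /\
    exists psi : R -> X, forall t,
      h (t + s (e n)) @[n --> \oo] --> psi t /\
      psi (t - s (e n)) @[n --> \oo] --> h t.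

Definition C0 (h : R -> X) : Prop :=
  bounded_continuous h /\ nrm (h t) @[t --> +oo] --> (0 : R).

Definition AAA (h : R -> X) : Prop :=
  bounded_continuous h /\
  exists h1 h2, [/\ AA h1, C0 h2 & forall t, h t = h1 t + h2 t].

Context {Y : normedModType R[i]}.

Definition AA_param (h : R * Y -> X) : Prop :=
  bounded_continuous h /\
  forall (Q : set Y) (s : nat -> R), compact Q ->
    exists e : nat -> nat, {homo e : m n / (m < n)%N} /\
    exists psi : R -> Y -> X, forall t y, Q y ->
      h (t + s (e n), y) @[n --> \oo] --> psi t y /\
      psi (t - s (e n)) y @[n --> \oo] --> h (t, y).

Definition C0_param (h : R * Y -> X) : Prop :=
  bounded_continuous h /\
  forall B : set Y, bounded_set B -> forall eps : R, 0 < eps ->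
    \forall t \near +oo, forall y, B y -> nrm (h (t, y)) < eps.

Definition AAA_param (h : R * Y -> X) : Prop :=
  bounded_continuous h /\
  exists h1 h2, [/\ AA_param h1, C0_param h2 & forall p, h p = h1 p + h2 p].

End AlmostAutomorphic.

Section MildSolution.
Context {R : realType} {X : completeNormedModType R[i]}.

Definition K_op (k : R -> R[i]) (u : R -> X) (t : R) : X :=
  bochner_int `]-oo, t[ (fun s => k (t - s) *: u s).

Definition mild_integrand (S : R -> X -> X) (f : R * (X * X) -> X)
    (k : R -> R[i]) (u : R -> X) (t s : R) : X :=
  S (t - s) (f (s, (u s, K_op k u s))).

Definition mild_solution (S : R -> X -> X) (f : R * (X * X) -> X)
    (k : R -> R[i]) (u : R -> X) : Prop :=
  forall t, bochner_integrable `]-oo, t[ (mild_integrand S f k u t)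
            /\ u t = bochner_int `]-oo, t[ (mild_integrand S f k u t).

End MildSolution.

(* Main.v *)
Require Import Defs.
From HB Require Import structures.
From mathcomp Require Import all_boot all_order all_algebra.
From mathcomp Require Import complex.
From mathcomp Require Import all_classical all_reals all_analysis.
From mathcomp Require Import measurable_realfun ring lra.

Set Implicit Arguments.
Unset Strict Implicit.
Unset Printing Implicit Defensive.

Import Order.TTheory GRing.Theory Num.Theory.
Import numFieldNormedType.Exports.

Local Open Scope classical_set_scope.
Local Open Scope ring_scope.
Local Open Scope complex_scope.

(** The mild solutions are the fixed points of [u |-> S_alpha * f(., u, K u)],
    where both [K] and the convolution with [S_alpha] are convolutions on the
    half-line whose operator kernels are bounded in norm by integrable weights:
    [|k|] for [K], and [b(t) = C M / (1 + |omega| t ^ alpha)] for [S_alpha]. Apart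
    from the strong continuity of the family and this bound, nothing about the
    operator [A] is needed.

    Everything about such a convolution [J] with weight [w] follows from one
    estimate ([convolution_like]): the distance of [J u t] and [J v t'] is at most
    the integral over [r >= 0] of [w r] times the distance of [u (t - r)] and
    [v (t' - r)]. With dominated convergence for real functions it shows that [J]
    is Lipschitz with the mass of [w] as constant ([conv_lip]) and preserves
    bounded continuous functions ([conv_bc]), almost automorphic functions
    ([conv_AA]) and functions that agree asymptotically at infinity ([conv_C0]).
    Proving the estimate means developing the Bochner integral: the distance of two
    integrals is at most the integral of the distance ([bochner_dist]), and the two
    kinds of integrands are integrable ([is_bochner_kernel], [is_bochner_dominated]).

    Write [f = f1 + f2] with [f1] almost automorphic in the parameter and [f2]
    vanishing. Translating [f] to infinity kills [f2], so [f1] inherits the Lipschitz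
    constant of [f] ([AA_part_lipschitz]); as an almost automorphic function has
    relatively compact range ([AA_compact_range]), composition with [f1] preserves
    almost automorphy ([superposition_AA]). Since [Lambda < 1], the operator
    attached to [f1] is a contraction of the almost automorphic functions, which are
    closed under uniform limits by a diagonal extraction ([uniform_limit_AA]); let
    [u1] be its fixed point. The operator attached to [f] is a contraction of the
    bounded continuous functions [u] with [u - u1] vanishing at infinity, and its
    fixed point there is the solution ([mild_operator_fixpoint]). Uniqueness is the
    contraction property again.

    The contraction constant requires the mass of [b], that is, the bound
    [|omega| ^ (- 1 / alpha) pi / (alpha sin (pi / alpha))] for the integral of
    [1 / (1 + |omega| t ^ alpha)] ([integral_decay_le]). Bounding the integrand by odd
    partial sums of the geometric series, in powers of [t ^ alpha] or of its inverse,
    and integrating termwise, it reduces to the partial fraction expansion of the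
    cosecant ([csc_sum_cvg]), which is the Fourier series of [cos (a x)] at the
    origin: the mean value theorem is applied to a primitive of [cos (a x) - 1]
    times the Dirichlet kernel, after a correction that makes its derivative small. *)

(** * The real-valued norm *)

Section Norm.
Context {R : realType}.

(** The norm of a complex normed space is the real number [nrm], seen in R[i]. *)
Lemma normE_nrm (V : normedZmodType R[i]) (x : V) : `|x| = (nrm x)%:C.
Proof.
have := normr_ge0 x; rewrite /nrm; case: `|x| => a b /=.
by rewrite lecE /= => /andP[/eqP -> _].
Qed.

Section NormedZmod.
Context {V : normedZmodType R[i]}.
Implicit Types x y z : V.

Lemma nrm_ge0 x : 0 <= nrm x.
Proof. by rewrite -ler0c -normE_nrm. Qed.

Lemma nrmD x y : nrm (x + y) <= nrm x + nrm y.
Proof. by rewrite -lecR rmorphD/= -!normE_nrm ler_normD. Qed.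

Lemma nrmN x : nrm (- x) = nrm x.
Proof. by rewrite /nrm normrN. Qed.

Lemma nrmB x y : nrm (x - y) = nrm (y - x).
Proof. by rewrite -nrmN opprB. Qed.

Lemma nrm0 : nrm (0 : V) = 0.
Proof. by rewrite /nrm normr0. Qed.

Lemma nrm0_eq0 x : nrm x = 0 -> x = 0.
Proof. by move=> x0; apply: normr0_eq0; rewrite normE_nrm x0. Qed.

Lemma nrm_dist x y z : nrm (x - z) <= nrm (x - y) + nrm (y - z).
Proof. by rewrite (le_trans _ (nrmD _ _))// addrA subrK. Qed.

Lemma nrm_lipschitz x y : `|nrm x - nrm y| <= nrm (x - y).
Proof.
rewrite ler_norml; have := nrmD (x - y) y; have := nrmD (y - x) x.
by rewrite !subrK (nrmB y); lra.
Qed.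

End NormedZmod.

Lemma nrmZ (V : normedModType R[i]) (a : R[i]) (x : V) :
  nrm (a *: x) = nrm a * nrm x.
Proof. by rewrite {1}/nrm normrZ !normE_nrm -rmorphM. Qed.

Lemma nrm_real (a : R) : nrm a%:C = `|a|.
Proof. by rewrite /nrm normc_def /= expr0n/= addr0 sqrtr_sqr. Qed.

Section NormedMod.
Context {V : normedModType R[i]}.

Lemma cvg_nrmP (T : Type) (F : set_system T) (FF : Filter F) (h : T -> V) (l : V) :
  h t @[t --> F] --> l <->
  forall e : R, 0 < e -> \forall t \near F, nrm (h t - l) < e.
Proof.
split=> [/cvgrPdist_lt hl e e0|hl].
  have := hl e%:C; rewrite ltcR => /(_ e0); apply: filterS => t.
  by rewrite normE_nrm ltcR nrmB.
apply/cvgrPdist_lt => -[a b]; rewrite ltcE/= => /andP[/eqP -> a0].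
by move: (hl _ a0); apply: filterS => t; rewrite normE_nrm nrmB -ltcR.
Qed.

Lemma cvg_nrm0P (T : Type) (F : set_system T) (FF : Filter F) (h : T -> V) (l : V) :
  h t @[t --> F] --> l <-> nrm (h t - l) @[t --> F] --> (0 : R).
Proof.
rewrite cvg_nrmP; split => [hl|/cvgr0Pnorm_lt hl e e0].
  apply/cvgr0Pnorm_lt => e /hl; apply: filterS => t.
  by rewrite ger0_norm ?nrm_ge0.
by move: (hl _ e0); apply: filterS => t; rewrite ger0_norm ?nrm_ge0.
Qed.

Lemma cvg_nrm (T : Type) (F : set_system T) (FF : Filter F) (h : T -> V) (l : V) :
  h t @[t --> F] --> l -> nrm (h t) @[t --> F] --> nrm l.
Proof.
move=> /cvg_nrmP hl; apply/cvgrPdist_lt => e /hl; apply: filterS => t.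
by apply: le_lt_trans; rewrite distrC nrm_lipschitz.
Qed.

(** Squeezing a function whose distance to [l] is dominated by a real one. *)
Lemma cvg_nrm_le (T : Type) (F : set_system T) (FF : Filter F)
    (h : T -> V) (l : V) (c : T -> R) :
  (\forall t \near F, nrm (h t - l) <= c t) -> c t @[t --> F] --> (0 : R) ->
  h t @[t --> F] --> l.
Proof.
move=> hc c0; apply/cvg_nrm0P.
apply: (@squeeze_cvgr _ _ _ _ (cst 0) c) => //; last exact: cvg_cst.
by apply: filterS hc => t ->; rewrite nrm_ge0.
Qed.

Lemma nrm_lim_le (T : Type) (F : set_system T) (FF : ProperFilter F) (h : T -> V)
    (l : V) (c : R) :
  (\forall t \near F, nrm (h t) <= c) -> h t @[t --> F] --> l -> nrm l <= c.
Proof.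
move=> hc /cvg_nrm hl; rewrite -(cvg_lim _ hl)//.
by apply: limr_le => //; apply/cvg_ex; exists (nrm l).
Qed.

End NormedMod.

Lemma cauchy_nrm_cvg (V : completeNormedModType R[i]) (x : nat -> V) :
  (forall e : R, 0 < e -> exists N, forall m n, (N <= m)%N -> (N <= n)%N ->
     nrm (x m - x n) < e) ->
  exists l : V, x n @[n --> \oo] --> l.
Proof.
move=> cx; exists (lim (x @ \oo)); apply: cauchy_cvg.
apply/cauchy_ballP => -[a b]; rewrite ltcE/= => /andP[/eqP -> a0].
have [N hN] := cx _ a0.
exists ([set x n | n in [set n | N <= n]%N], [set x n | n in [set n | N <= n]%N]) => /=.
  by split; exists N => // n Nn; exists n.
move=> [_ _] [/= [m Nm <-] [n Nn <-]].
by rewrite -ball_normE/= normE_nrm ltcR hN.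
Qed.

End Norm.

(** * Integrals of arbitrary nonnegative functions, and step functions *)

Section LowerIntegral.
Local Open Scope ereal_scope.
Context d (T : measurableType d) (R : realType).
Variable mu : {measure set T -> \bar R}.
Implicit Types (D N : set T) (f g : T -> \bar R).
Import HBNNSimple.

(** The two facts below need no measurability of the integrand, because the
    integral of a nonnegative function is a supremum over simple minorants. *)
Lemma ge0_integral_le D f g : (forall x, D x -> 0 <= f x) ->
  (forall x, D x -> f x <= g x) ->
  \int[mu]_(x in D) f x <= \int[mu]_(x in D) g x.
Proof.
move=> f0 fg; rewrite !ge0_integralE//; last first.
  by move=> x Dx; rewrite (le_trans _ (fg _ Dx)) ?f0.
apply: ereal_sup_le => _ [h /= hf <-].
exists h => //= x; apply: le_trans (hf x) _; rewrite !patchE.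
by case: ifPn => //; rewrite inE => /fg.
Qed.

Lemma ge0_integral_setD_null D N f : measurable N -> mu N = 0 ->
  (forall x, D x -> 0 <= f x) ->
  \int[mu]_(x in D) f x = \int[mu]_(x in D `\` N) f x.
Proof.
move=> mN N0 f0; rewrite !ge0_integralE//; last by move=> x [/f0].
apply/eqP; rewrite eq_le; apply/andP; split; last first.
  apply: ereal_sup_le => _ [h /= hf <-].
  exists h => //= x; apply: le_trans (hf x) _; rewrite !patchE in_setD.
  by case: (boolP (x \in D)) => //= ; rewrite inE => /f0; case: ifP.
apply: ge_ereal_sup => _ [h /= hf <-]; apply: le_ereal_sup_tmp.
have mNc : measurable (~` N) by exact: measurableC.
have [p pE] : exists p : {nnsfun T >-> R}, (p : T -> R) = (h : T -> R) \_ (~` N).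
  by exists (proj_nnsfun h mNc); rewrite (mrestrict h mNc).
exists (sintegral mu p).
  exists p => //= x; move: (hf x); rewrite pE !patchE in_setD in_setC.
  by case: (x \in D); case: (x \in N).
rewrite -!integralT_nnsfun (ge0_negligible_integral mN)//; last 2 first.
- by apply/measurable_EFinP.
- by move=> x _; rewrite lee_fin.
rewrite [leRHS](ge0_negligible_integral mN)//; last 2 first.
- by apply/measurable_EFinP.
- by move=> x _; rewrite lee_fin.
apply: ge0_integral_le; first by move=> x _; rewrite lee_fin.
by move=> x [_ Nx]; rewrite pE patchE in_setC memNset.
Qed.

End LowerIntegral.

Section StepFunctions.
Context {R : realType} {X : normedModType R[i]}.
Local Notation mu := (@lebesgue_measure R).
Implicit Types (D E A : set R) (s : seq (set R * X)).

(** The sets of the list [s] are Borel. *)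
Definition step_measurable s : Prop :=
  forall p, p \in s -> measurable (p.1 : set (measurableTypeR R)).

Lemma simple_on_measurable D s : simple_on D s -> step_measurable s.
Proof. by move=> h p /h []. Qed.

Lemma step_fun_nil t : step_fun ([::] : seq (set R * X)) t = 0.
Proof. by rewrite /step_fun big_nil. Qed.

Lemma step_fun_cons A x s t :
  step_fun ((A, x) :: s) t = (if t \in A then x else 0) + step_fun s t.
Proof.
rewrite /step_fun big_cons /= indicE; congr (_ + _).
by case: (t \in A); rewrite ?scale1r ?scale0r.
Qed.

Lemma step_fun_cat s s' t : step_fun (s ++ s') t = step_fun s t + step_fun s' t.
Proof. by rewrite /step_fun big_cat. Qed.

(** The list representing the opposite step function. *)
Definition step_opp s := [seq (p.1, - p.2) | p <- s].

Lemma step_fun_opp s t : step_fun (step_opp s) t = - step_fun s t.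
Proof.
rewrite /step_fun big_map -sumrN; apply: eq_bigr => p _.
by rewrite scalerN.
Qed.

Lemma step_int_cons D A x s :
  step_int D ((A, x) :: s) = (fine (mu (D `&` A)))%:C *: x + step_int D s.
Proof. by rewrite /step_int big_cons. Qed.

Lemma step_int_cat D s s' : step_int D (s ++ s') = step_int D s + step_int D s'.
Proof. by rewrite /step_int big_cat. Qed.

Lemma step_int_opp D s : step_int D (step_opp s) = - step_int D s.
Proof.
rewrite /step_int big_map -sumrN; apply: eq_bigr => p _.
by rewrite scalerN.
Qed.

Lemma simple_on_cat D s s' :
  simple_on D s -> simple_on D s' -> simple_on D (s ++ s').
Proof. by move=> h h' p; rewrite mem_cat => /orP[/h|/h']. Qed.

Lemma simple_on_opp D s : simple_on D s -> simple_on D (step_opp s).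
Proof. by move=> h p /mapP[q /h qs ->]. Qed.

Lemma measurable_nrm_step s x E : measurable (E : set (measurableTypeR R)) ->
  step_measurable s -> measurable_fun (E : set (measurableTypeR R))
    (fun t => nrm (x + step_fun s t) : R).
Proof.
move=> + ms; elim: s x E ms => [|[A y] s IH] x E ms mE.
  by under eq_fun do rewrite step_fun_nil addr0; exact: measurable_cst.
have mA : measurable (A : set (measurableTypeR R)) by exact: (ms (A, y) (mem_head _ _)).
have {}ms : step_measurable s by move=> p ps; apply: ms; rewrite inE ps orbT.
rewrite -(setUIDK E A); apply/measurable_funU; [exact: measurableI|exact: measurableD|].
split.
- apply: (eq_measurable_fun (fun t => nrm ((x + y) + step_fun s t))).
    by move=> t; rewrite inE => -[_ At]; rewrite step_fun_cons mem_set// addrA.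
  by apply: IH => //; exact: measurableI.
- apply: (eq_measurable_fun (fun t => nrm (x + step_fun s t))).
    by move=> t; rewrite inE => -[_ At]; rewrite step_fun_cons memNset// add0r.
  by apply: IH => //; exact: measurableD.
Qed.

Lemma measurable_nrm_stepB s s' E : measurable (E : set (measurableTypeR R)) ->
  step_measurable s -> step_measurable s' ->
  measurable_fun (E : set (measurableTypeR R))
    (fun t => nrm (step_fun s t - step_fun s' t) : R).
Proof.
move=> mE ms ms'; under eq_fun do rewrite -step_fun_opp -step_fun_cat -[_ (_ ++ _) _]add0r.
apply: measurable_nrm_step => // p; rewrite mem_cat => /orP[/ms//|/mapP[q qs' ->]].
exact: ms' q qs'.
Qed.

End StepFunctions.

(** * Integrals of step functions *)

Section StepIntegral.
Context {R : realType} {X : normedModType R[i]}.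
Local Notation mu := (@lebesgue_measure R).
Implicit Types (D E A : set R) (s : seq (set R * X)).

Lemma fine_measure_split E A B : measurable (A : set (measurableTypeR R)) ->
  measurable (B : set (measurableTypeR R)) ->
  measurable (E : set (measurableTypeR R)) -> (mu (E `&` B) < +oo)%E ->
  fine (mu (E `&` B)) =
    fine (mu ((E `&` A) `&` B)) + fine (mu ((E `\` A) `&` B)).
Proof.
move=> mA mB mE fin.
have mEB : measurable (E `&` B : set (measurableTypeR R)) by exact: measurableI.
have -> : (E `&` A) `&` B = (E `&` B) `&` A by rewrite setIAC.
have -> : (E `\` A) `&` B = (E `&` B) `\` A by rewrite !setDE setIAC.
rewrite -fineD.
- by congr fine; rewrite addeC; exact: (measureDI mu).
- rewrite ge0_fin_numE// (le_lt_trans _ fin)// le_measure// ?inE//.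
  exact: measurableI.
- rewrite ge0_fin_numE// (le_lt_trans _ fin)// le_measure// ?inE//.
  exact: measurableD.
Qed.

Lemma step_int_split E A s : measurable (E : set (measurableTypeR R)) ->
  measurable (A : set (measurableTypeR R)) -> simple_on E s ->
  step_int E s = step_int (E `&` A) s + step_int (E `\` A) s.
Proof.
move=> mE mA ss; rewrite /step_int -big_split/=; apply: eq_big_seq => p ps.
have [mp fp] := ss _ ps.
by rewrite (fine_measure_split mA mp mE fp) rmorphD scalerDl.
Qed.

(** The constant [x] makes the induction on the list go through: the sets of the
    list need not be disjoint, and splitting the domain along one of them adds
    its vector to the constant on one of the two pieces. *)
Lemma nrm_step_int_cst s x E : measurable (E : set (measurableTypeR R)) ->
  x = 0 \/ (mu E < +oo)%E -> simple_on E s ->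
  ((nrm ((fine (mu E))%:C *: x + step_int E s))%:E <=
    \int[mu]_(t in E) (nrm (x + step_fun s t))%:E)%E.
Proof.
elim: s x E => [|[A y] s IH] x E mE xE ss.
  rewrite /step_int big_nil addr0.
  under eq_integral do rewrite step_fun_nil addr0.
  rewrite integral_cst// nrmZ nrm_real; case: xE => [->|Efin].
    by rewrite nrm0 mulr0 mul0e.
  rewrite ger0_norm; last by rewrite fine_ge0.
  rewrite EFinM fineK; first by rewrite muleC.
  by rewrite ge0_fin_numE.
have [mA EA] := ss (A, y) (mem_head _ _).
have {}ss : simple_on E s by move=> p ps; apply: ss; rewrite inE ps orbT.
have ms := simple_on_measurable ss.
have mEA : measurable (E `&` A : set (measurableTypeR R)) by exact: measurableI.
have mEDA : measurable (E `\` A : set (measurableTypeR R)) by exact: measurableD.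
have sub (F : set R) : measurable (F : set (measurableTypeR R)) -> F `<=` E ->
    simple_on F s.
  move=> mF FE p ps; have [mp fp] := ss p ps; split => //.
  apply: le_lt_trans fp; rewrite le_measure ?inE//=; [exact: measurableI..|].
  exact: setSI.
have ss1 : simple_on (E `&` A) s by apply: sub => //; exact: subIsetl.
have ss2 : simple_on (E `\` A) s by apply: sub => //; exact: subDsetl.
have := IH (x + y) _ mEA (or_intror EA) ss1.
have xE2 : x = 0 \/ (mu (E `\` A) < +oo)%E.
  case: xE => [->|fE]; [by left|right; apply: le_lt_trans fE].
  by rewrite le_measure ?inE//; exact: subDsetl.
have := IH x _ mEDA xE2 ss2.
have mstep : measurable_fun (E : set (measurableTypeR R))
    (fun t => (nrm (x + step_fun ((A, y) :: s) t))%:E).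
  apply/measurable_EFinP; apply: measurable_nrm_step => // p.
  by rewrite inE => /orP[/eqP ->//|/ms].
have -> : (\int[mu]_(t in E) (nrm (x + step_fun ((A, y) :: s) t))%:E =
  \int[mu]_(t in E `&` A) (nrm (x + y + step_fun s t))%:E +
   \int[mu]_(t in E `\` A) (nrm (x + step_fun s t))%:E)%E.
  rewrite -{1}(setUIDK E A) ge0_integral_setU ?setUIDK//; last 2 first.
  - by move=> t _; rewrite lee_fin nrm_ge0.
  - by apply/disj_setPS => t [[_ At] []].
  congr (_ + _)%E; apply: eq_integral => t; rewrite inE => -[_ At].
  - by rewrite step_fun_cons mem_set// addrA.
  - by rewrite step_fun_cons memNset// add0r.
move=> /[swap] /leeD/[apply]; apply: le_trans.
rewrite -EFinD lee_fin; apply: le_trans (nrmD _ _).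
rewrite step_int_cons (step_int_split mE mA ss) scalerDr.
suff -> : (fine (mu E))%:C *: x =
    (fine (mu (E `&` A)))%:C *: x + (fine (mu (E `\` A)))%:C *: x.
  by rewrite (addrA (_ *: y)) addrACA (addrA _ (_ *: y)).
case: xE => [->|fE]; first by rewrite !scaler0 addr0.
have := @fine_measure_split E A setT mA measurableT mE.
by rewrite !setIT => /(_ fE) ->; rewrite rmorphD scalerDl.
Qed.

Lemma nrm_step_int s D : measurable (D : set (measurableTypeR R)) ->
  simple_on D s ->
  ((nrm (step_int D s))%:E <= \int[mu]_(t in D) (nrm (step_fun s t))%:E)%E.
Proof.
move=> mD ss; have := nrm_step_int_cst mD (or_introl erefl) ss.
by rewrite scaler0 add0r; under eq_integral do rewrite add0r.
Qed.

Lemma nrm_step_intB s s' D : measurable (D : set (measurableTypeR R)) ->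
  simple_on D s -> simple_on D s' ->
  ((nrm (step_int D s - step_int D s'))%:E <=
    \int[mu]_(t in D) (nrm (step_fun s t - step_fun s' t))%:E)%E.
Proof.
move=> mD ss ss'; rewrite -step_int_opp -step_int_cat.
under eq_integral do rewrite -step_fun_opp -step_fun_cat.
by apply: nrm_step_int => //; apply: simple_on_cat => //; exact: simple_on_opp.
Qed.

End StepIntegral.

(** * Bochner integral *)

Section BochnerTheory.
Context {R : realType} {X : normedModType R[i]}.
Local Notation mu := (@lebesgue_measure R).
Local Notation mset := (set (measurableTypeR R)).
Implicit Types (D E A N : set R) (s : seq (set R * X)) (g h : R -> X).

Lemma measurable_nrm_lim E (s s' : nat -> seq (set R * X)) g h :
  measurable (E : mset) ->
  (forall n, step_measurable (s n)) -> (forall n, step_measurable (s' n)) ->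
  (forall t, E t -> step_fun (s n) t @[n --> \oo] --> g t) ->
  (forall t, E t -> step_fun (s' n) t @[n --> \oo] --> h t) ->
  measurable_fun (E : mset) (fun t => nrm (g t - h t) : R).
Proof.
move=> mE ms ms' sg s'h.
apply: (@measurable_fun_cvg _ _ _ _
    (fun n t => nrm (step_fun (s n) t - step_fun (s' n) t) : R)).
- by move=> n; exact: measurable_nrm_stepB.
- by move=> t Et; apply: cvg_nrm; apply: cvgB; [exact: sg|exact: s'h].
Qed.

Lemma measurable_nrm_limB E (s : nat -> seq (set R * X)) s' g :
  measurable (E : mset) ->
  (forall n, step_measurable (s n)) -> step_measurable s' ->
  (forall t, E t -> step_fun (s n) t @[n --> \oo] --> g t) ->
  measurable_fun (E : mset) (fun t => nrm (g t - step_fun s' t) : R).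
Proof.
move=> mE ms ms' sg.
by apply: (@measurable_nrm_lim E s (fun=> s')) => // t _; exact: cvg_cst.
Qed.

Local Open Scope ereal_scope.

(** Triangle inequality under the integral sign, with three terms. *)
Lemma integral_nrm_dist3 E (a b c : R -> X) (F : R -> R) :
  measurable (E : mset) -> 
  measurable_fun (E : mset) (fun t => nrm (a t) : R) ->
  measurable_fun (E : mset) (fun t => nrm (b t) : R) ->
  measurable_fun (E : mset) (fun t => nrm (c t) : R) ->
  (forall t, E t -> 0 <= F t <= nrm (a t) + nrm (b t) + nrm (c t))%R ->
  \int[mu]_(t in E) (F t)%:E <=
    \int[mu]_(t in E) (nrm (a t))%:E + \int[mu]_(t in E) (nrm (b t))%:E
    + \int[mu]_(t in E) (nrm (c t))%:E.
Proof.
move=> mE ma mb mc FE.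
rewrite -ge0_integralD//; first last; try by apply/measurable_EFinP.
- by move=> t _; rewrite lee_fin nrm_ge0.
- by move=> t _; rewrite lee_fin nrm_ge0.
rewrite -ge0_integralD//; first last; try by apply/measurable_EFinP.
- by move=> t _; rewrite lee_fin nrm_ge0.
- by apply/measurable_EFinP; apply: measurable_funD.
- by move=> t _; rewrite adde_ge0// lee_fin nrm_ge0.
apply: ge0_integral_le => t Et; rewrite ?lee_fin.
- by case/andP: (FE _ Et).
- by case/andP: (FE _ Et).
Qed.

(** Linearity and the norm estimate at once; with [g = h], the uniqueness of
    the integral. *)
Lemma bochner_dist D g h v w : measurable (D : mset) ->
  is_bochner D g v -> is_bochner D h w ->
  (nrm (v - w))%:E <= \int[mu]_(t in D) (nrm (g t - h t))%:E.
Proof.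
move=> mD [s [ss [N1 [mN1 N10 sg]] Is sv]] [s' [ss' [N2 [mN2 N20 s'h]] Is' s'w]].
pose N := N1 `|` N2.
(* Outside the null set N all functions are limits of step functions, hence
   measurable; the integrals over D and over D minus N agree. *)
have mN : measurable (N : mset) by exact: measurableU.
have N0 : mu N = 0 by rewrite null_set_setU.
pose E := D `\` N.
have mE : measurable (E : mset) by exact: measurableD.
have sgE t : E t -> step_fun (s n) t @[n --> \oo] --> g t.
  move=> [Dt Nt]; apply: contrapT => nc; apply: Nt; left; apply: sg => /=.
  by move/(_ Dt).
have s'hE t : E t -> step_fun (s' n) t @[n --> \oo] --> h t.
  move=> [Dt Nt]; apply: contrapT => nc; apply: Nt; right; apply: s'h => /=.
  by move/(_ Dt).
have ms n := simple_on_measurable (ss n).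
have ms' n := simple_on_measurable (ss' n).
have bound n : (nrm (step_int D (s n) - step_int D (s' n)))%:E <=
    \int[mu]_(t in D) (nrm (g t - step_fun (s n) t))%:E +
    \int[mu]_(t in D) (nrm (g t - h t))%:E +
    \int[mu]_(t in D) (nrm (h t - step_fun (s' n) t))%:E.
  apply: (le_trans (nrm_step_intB mD (ss n) (ss' n))).
  rewrite !(@ge0_integral_setD_null _ _ _ mu D N)//;
    try by move=> t _; rewrite lee_fin nrm_ge0.
  apply: integral_nrm_dist3 => //; rewrite -/E.
  - exact: measurable_nrm_limB sgE.
  - exact: measurable_nrm_lim sgE s'hE.
  - exact: measurable_nrm_limB s'hE.
  move=> t _; rewrite nrm_ge0/= (nrmB (g t) (step_fun _ _)).
  rewrite (le_trans (nrm_dist _ (h t) _))// lerD2r.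
  by rewrite (le_trans (nrm_dist _ (g t) _)).
have Jge0 : 0 <= \int[mu]_(t in D) (nrm (g t - h t))%:E.
  by apply: integral_ge0 => t _; rewrite lee_fin nrm_ge0.
have cL : (nrm (step_int D (s n) - step_int D (s' n)))%:E @[n --> \oo]
    --> (nrm (v - w))%:E.
  apply: cvg_EFin; first exact: nearW.
  by apply: cvg_nrm; exact: cvgB.
have cR : (\int[mu]_(t in D) (nrm (g t - step_fun (s n) t))%:E +
    \int[mu]_(t in D) (nrm (g t - h t))%:E +
    \int[mu]_(t in D) (nrm (h t - step_fun (s' n) t))%:E) @[n --> \oo]
    --> 0 + \int[mu]_(t in D) (nrm (g t - h t))%:E + 0.
  apply: cvgeD => //; [exact: fin_num_adde_defl|].
  by apply: cvgeD => //; exact: cvg_cst.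
rewrite add0e adde0 in cR.
by apply: lee_cvg_to cL cR _; exact: nearW.
Qed.

Lemma bochner_unique D g v w : measurable (D : mset) ->
  is_bochner D g v -> is_bochner D g w -> v = w.
Proof.
move=> mD gv gw; apply/eqP; rewrite -subr_eq0; apply/eqP/nrm0_eq0.
apply/eqP; rewrite eq_le nrm_ge0 andbT -lee_fin.
rewrite (le_trans (bochner_dist mD gv gw))// integral0_eq// => t _.
by rewrite subrr nrm0.
Qed.

Lemma bochner_intE D g v : measurable (D : mset) ->
  is_bochner D g v -> bochner_int D g = v.
Proof.
move=> mD gv; rewrite /bochner_int; case: xgetP => [w _ gw|/(_ v)//].
exact: bochner_unique gw gv.
Qed.

End BochnerTheory.

Section BochnerExistence.
Context {R : realType} {X : completeNormedModType R[i]}.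
Local Notation mu := (@lebesgue_measure R).
Local Notation mset := (set (measurableTypeR R)).
Local Open Scope ereal_scope.

(** The integrals of the approximations converge by completeness. *)
Lemma is_bochner_ex (D : set R) (g : R -> X) (s : nat -> seq (set R * X)) :
  measurable (D : mset) -> (forall n, simple_on D (s n)) ->
  {ae mu, forall t, D t -> step_fun (s n) t @[n --> \oo] --> g t} ->
  \int[mu]_(t in D) (nrm (g t - step_fun (s n) t))%:E @[n --> \oo] --> 0 ->
  exists v, is_bochner D g v.
Proof.
move=> mD ss sg Is.
suff [v sv] : exists v : X, step_int D (s n) @[n --> \oo] --> v.
  by exists v, s; split.
have [N [mN N0 sgN]] := sg.
pose E := D `\` N.
have mE : measurable (E : mset) by exact: measurableD.
have sgE t : E t -> step_fun (s n) t @[n --> \oo] --> g t.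
  move=> [Dt Nt]; apply: contrapT => nc; apply: Nt; apply: sgN => /=.
  by move/(_ Dt).
have ms n := simple_on_measurable (ss n).
apply: cauchy_nrm_cvg => e e0.
have e20 : (0 < e / 2)%R by rewrite divr_gt0.
have : \forall n \near \oo,
    \int[mu]_(t in D) (nrm (g t - step_fun (s n) t))%:E < (e / 2)%:E.
  apply: (Is [set x : \bar R | x < (e / 2)%:E]); apply: open_nbhs_nbhs.
  by split; [exact: open_ereal_lt_ereal|rewrite /= lte_fin].
move=> [n0 _ hn0]; exists n0 => m n /hn0/= Im /hn0/= In.
rewrite -lte_fin (le_lt_trans (nrm_step_intB mD (ss m) (ss n)))//.
apply: (@le_lt_trans _ _ (
  \int[mu]_(t in D) (nrm (g t - step_fun (s m) t))%:E +
  \int[mu]_(t in D) (nrm (g t - step_fun (s n) t))%:E +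
  \int[mu]_(t in D) (nrm (0 : X))%:E)); last first.
  rewrite nrm0 integral_cst// mul0e adde0.
  by rewrite [ltRHS](_ : _ = (e / 2)%:E + (e / 2)%:E) ?lteD// -EFinD -splitr.
rewrite !(@ge0_integral_setD_null _ _ _ mu D N)//;
    try by move=> t _; rewrite lee_fin nrm_ge0.
apply: integral_nrm_dist3 => //; rewrite -/E.
- exact: measurable_nrm_limB sgE.
- exact: measurable_nrm_limB sgE.
move=> t _; rewrite nrm_ge0/= nrm0 addr0 (nrmB (g t)).
exact: nrm_dist.
Qed.

End BochnerExistence.

(** * Reflection of the real line *)

Section Reflection.
Context {R : realType}.
Local Notation mu := (@lebesgue_measure R).
Local Notation mset := (set (measurableTypeR R)).
Variable t : R.

(** The change of variable exchanging the past of [t] and the half-line. *)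
Definition reflect (s : R) : R := t - s.

Lemma measurable_reflect :
  measurable_fun [set: measurableTypeR R] (reflect : R -> measurableTypeR R).
Proof. exact: measurable_funB. Qed.

Lemma measurable_preimage_reflect (A : set R) : measurable (A : mset) ->
  measurable (reflect @^-1` A : mset).
Proof. by move=> mA; rewrite -[X in measurable X]setTI; exact: measurable_reflect. Qed.

Lemma lebesgue_measure_reflect (A : set R) : measurable (A : mset) ->
  mu (reflect @^-1` A) = mu A.
Proof.
move=> mA; apply/esym; pose nu :=
  measure_function_pushforward__canonical__measure_function_Measure mu measurable_reflect.
apply: (@lebesgue_measure_unique R nu) => // _ [[a b] _ <-] /=.
rewrite /pushforward.
have -> : reflect @^-1` `]a, b] = `[t - b, t - a[%classic.
  by apply/seteqP; split => s /=; rewrite /reflect !in_itv/=; lra.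
rewrite !lebesgue_measure_itv/= !lte_fin ltrD2l ltrN2.
by case: ifP => // _; rewrite -!EFinD; congr EFin; lra.
Qed.

Lemma ge0_integral_reflect (D : set R) (f : R -> \bar R) : measurable (D : mset) ->
  measurable_fun (D : mset) f -> (forall x, D x -> 0 <= f x)%E ->
  (\int[mu]_(s in reflect @^-1` D) f (reflect s) = \int[mu]_(r in D) f r)%E.
Proof.
move=> mD mf f0; pose nu :=
  measure_function_pushforward__canonical__measure_function_Measure mu measurable_reflect.
have fE : (\int[mu]_(r in D) f r = \int[nu]_(r in D) f r)%E.
  by apply: eq_measure_integral => A mA _; have := lebesgue_measure_reflect mA.
have f0' : {in D, forall y, (0 <= f y)%E} by move=> y; rewrite inE => /f0.
by rewrite fE; exact/esym/(ge0_integral_pushforward measurable_reflect mu mD mf f0').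
Qed.

End Reflection.

Section BochnerReflection.
Context {R : realType} {X : normedModType R[i]}.
Local Notation mu := (@lebesgue_measure R).
Local Notation mset := (set (measurableTypeR R)).

Lemma measure_setD_null (A N : set R) : measurable (A : mset) ->
  measurable (N : mset) -> mu N = 0%E -> mu (A `\` N) = mu A.
Proof.
move=> mA mN N0; rewrite (measureDI _ mA mN) [X in (_ + X)%E](_ : _ = 0%E) ?adde0//.
by apply: (subset_measure0 _ _ _ N0) => //; exact: measurableI.
Qed.

Lemma is_bochner_setD_null (D N : set R) (g : R -> X) v :
  measurable (D : mset) -> measurable (N : mset) -> mu N = 0%E ->
  is_bochner D g v -> is_bochner (D `\` N) g v.
Proof.
move=> mD mN N0 [s [ss sg Is sv]]; exists s.
have muE A : measurable (A : mset) -> mu ((D `\` N) `&` A) = mu (D `&` A).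
  move=> mA; rewrite -[RHS](@measure_setD_null _ N)//; last exact: measurableI.
  by congr mu; rewrite !setDE setIAC.
split.
- by move=> n p ps; have [mp fp] := ss n p ps; rewrite muE.
- by move: sg; apply: (@filterS _ _ (ae_filter_ringOfSetsType mu)) => t + [Dt _]; apply.
- suff /funext -> : (fun n =>
      \int[mu]_(t in D `\` N) (nrm (g t - step_fun (s n) t))%:E)%E
    =1 (fun n => \int[mu]_(t in D) (nrm (g t - step_fun (s n) t))%:E)%E by [].
  move=> n; rewrite -ge0_integral_setD_null// => t _.
  by rewrite lee_fin nrm_ge0.
- suff /funext -> : (fun n => step_int (D `\` N) (s n))
    =1 (fun n => step_int D (s n)) by [].
  move=> n; apply: eq_big_seq => p ps; have [mp _] := ss n p ps.
  by rewrite muE.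
Qed.

Lemma is_bochner_preimage_reflect (t : R) (D : set R) (g : R -> X) v :
  measurable (D : mset) -> is_bochner D g v ->
  is_bochner (reflect t @^-1` D) (g \o reflect t) v.
Proof.
move=> mD [s [ss sg Is sv]].
pose s' n : seq (set R * X) := [seq (reflect t @^-1` p.1, p.2) | p <- s n].
have s'E n r : step_fun (s' n) r = step_fun (s n) (reflect t r).
  rewrite /step_fun big_map; apply: eq_bigr => p _; congr (_%:C *: _).
have muE A : measurable (A : mset) ->
    mu (reflect t @^-1` D `&` reflect t @^-1` A) = mu (D `&` A).
  move=> mA; rewrite -preimage_setI lebesgue_measure_reflect//.
  exact: measurableI.
have [N [mN N0 NE]] := sg.
have mN' := measurable_preimage_reflect t mN.
have N'0 : mu (reflect t @^-1` N) = 0%E by rewrite lebesgue_measure_reflect.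
have sgE r : (D `\` N) r -> step_fun (s n) r @[n --> \oo] --> g r.
  move=> [Dr Nr]; apply: contrapT => nc; apply: Nr; apply: NE => /=.
  by move/(_ Dr).
exists s'; split.
- move=> n _ /mapP[p ps ->] /=; have [mp fp] := ss n p ps; split.
    exact: measurable_preimage_reflect.
  by rewrite muE.
- exists (reflect t @^-1` N); split => // r /= nr; apply: NE => /= rE; apply: nr => Dr.
  by under eq_fun do rewrite s'E; exact: rE.
- suff /funext -> : (fun n =>
      \int[mu]_(r in reflect t @^-1` D) (nrm ((g \o reflect t) r - step_fun (s' n) r))%:E)%E
    =1 (fun n => \int[mu]_(r in D) (nrm (g r - step_fun (s n) r))%:E)%E by [].
  move=> n; under eq_integral do rewrite s'E /=.
  rewrite (@ge0_integral_setD_null _ _ _ mu _ (reflect t @^-1` N))//; last first.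
    by move=> ? _; rewrite lee_fin nrm_ge0.
  rewrite (@ge0_integral_setD_null _ _ _ mu D N)//; last first.
    by move=> ? _; rewrite lee_fin nrm_ge0.
  rewrite -(@ge0_integral_reflect _ t (D `\` N))//.
  - exact: measurableD.
  - apply/measurable_EFinP; apply: (@measurable_nrm_limB _ _ _ s) => //.
    + exact: measurableD.
    + by move=> m; exact: simple_on_measurable (ss m).
    + exact: simple_on_measurable (ss n).
  - by move=> ? _; rewrite lee_fin nrm_ge0.
- suff /funext -> : (fun n => step_int (reflect t @^-1` D) (s' n))
    =1 (fun n => step_int D (s n)) by [].
  move=> n; rewrite /step_int big_map; apply: eq_big_seq => p ps /=.
  by have [mp _] := ss n p ps; rewrite muE.
Qed.

(** The endpoint 0 is dropped because its image [t] is not in the open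
    half-line ending at [t]. *)
Lemma is_bochner_reflect (t : R) (g : R -> X) v :
  is_bochner `[0, +oo[ g v -> is_bochner `]-oo, t[ (fun s => g (t - s)) v.
Proof.
move=> /(@is_bochner_setD_null _ [set 0 : R]).
move=> /(_ (measurable_itv _) (measurable_set1 _) (lebesgue_measure_set1 _)).
have -> : `[0, +oo[ `\` [set 0 : R] = `]0, +oo[%classic.
  apply/seteqP; split => x /=; rewrite !in_itv/= !andbT.
    by move=> [x0 /eqP nx]; rewrite lt_neqAle x0 eq_sym nx.
  by move=> x0; split; [exact: ltW|apply/eqP; rewrite gt_eqF].
move=> /(is_bochner_preimage_reflect t (measurable_itv _)).
suff -> : reflect t @^-1` `]0, +oo[ = `]-oo, t[%classic by [].
by apply/seteqP; split => s /=; rewrite /reflect !in_itv/=; lra.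
Qed.

End BochnerReflection.

(** * Approximation by right endpoints, dominated convergence and integrability *)

Section RightEndpointApproximation.
Context {R : realType} {X : normedModType R[i]}.
Local Notation mu := (@lebesgue_measure R).
Local Notation mset := (set (measurableTypeR R)).
Implicit Types (u : R -> X) (n : nat).

(** Right continuity on the half-line. *)
Definition right_continuous u : Prop := forall r, 0 <= r -> forall e, 0 < e ->
  exists2 d, 0 < d & forall x, r <= x < r + d -> nrm (u x - u r) < e.

(** Points of the mesh of width [1/(n+1)]. *)
Definition mesh_point n j : R := j%:R / n.+1%:R.

(** The step function whose value on each interval of the mesh is the value of
    [u] at its right endpoint, the mesh being cut at [n+1]. Right endpoints are
    used so that a nonincreasing bound of [u] also bounds the approximation. *)
Definition right_steps u n : seq (set R * X) :=
  [seq (`[mesh_point n j, mesh_point n j.+1[%classic, u (mesh_point n j.+1))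
  | j <- index_iota 0 (n.+1 * n.+1)].

Lemma right_steps_simple u n : simple_on `[0, +oo[ (right_steps u n).
Proof.
move=> _ /mapP[j _ ->] /=; split; first exact: measurable_itv.
apply: (@le_lt_trans _ _ (mu `[mesh_point n j, mesh_point n j.+1[)).
  by rewrite le_measure ?inE//; exact: measurableI.
by rewrite lebesgue_measure_itv/=; case: ifP => _; rewrite ?ltry// -EFinD ltry.
Qed.

Lemma mem_mesh n j r : 0 <= r ->
  (r \in `[mesh_point n j, mesh_point n j.+1[%classic) =
  (j == Num.truncn (r * n.+1%:R)).
Proof.
move=> r0; rewrite /mesh_point mem_setE in_itv/= ler_pdivrMr ?ltr0Sn//.
rewrite ltr_pdivlMr ?ltr0Sn// eq_sym.
have r1 : 0 <= r * n.+1%:R by rewrite mulr_ge0.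
by apply/idP/eqP => [/truncn_def//|<-]; exact: truncn_itv.
Qed.

Lemma right_steps_fun u n r : 0 <= r ->
  step_fun (right_steps u n) r =
  if r < n.+1%:R then u (mesh_point n (Num.truncn (r * n.+1%:R)).+1) else 0.
Proof.
move=> r0; rewrite /step_fun /right_steps big_map.
under eq_bigr => j _.
  rewrite indicE mem_mesh// (_ : _ *: _ =
    if j == Num.truncn (r * n.+1%:R) then u (mesh_point n j.+1) else 0); last first.
    by case: ifP => _; rewrite ?scale1r ?scale0r.
  over.
rewrite -big_mkcond big_nat1_eq leq0n/=.
rewrite truncn_lt_nat ?mulr_ge0// natrM ltr_pM2r ?ltr0Sn//.
Qed.

Lemma mesh_point_truncn n r : 0 <= r ->
  r < mesh_point n (Num.truncn (r * n.+1%:R)).+1 <= r + n.+1%:R^-1.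
Proof.
move=> r0; rewrite /mesh_point ltr_pdivlMr ?ltr0Sn//.
have r1 : 0 <= r * n.+1%:R by rewrite mulr_ge0.
have /andP[h1 ->] := truncn_itv r1.
by rewrite ler_pdivrMr ?ltr0Sn// mulrDl mulVf ?pnatr_eq0// -natr1 lerD2r.
Qed.

(** The value at [r] is 0 or a value of [u] further to the right. *)
Lemma right_steps_value u n r : 0 <= r -> step_fun (right_steps u n) r = 0 \/
  exists2 r', r <= r' & step_fun (right_steps u n) r = u r'.
Proof.
move=> r0; rewrite right_steps_fun//; case: ifP => _; last by left.
have /andP[/ltW h _] := mesh_point_truncn n r0.
by right; exists (mesh_point n (Num.truncn (r * n.+1%:R)).+1).
Qed.

Lemma right_steps_cvg u r : right_continuous u -> 0 <= r ->
  step_fun (right_steps u n) r @[n --> \oo] --> u r.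
Proof.
move=> ru r0; apply/cvg_nrmP => e /(ru _ r0)[d d0 hd]; near=> n.
rewrite right_steps_fun// ifT; last first.
  near: n; exists (Num.truncn r) => // n /= rn.
  by rewrite (lt_le_trans (truncnS_gt _))// ler_nat.
have /andP[h1 h2] := mesh_point_truncn n r0.
apply: hd; rewrite (ltW h1) (le_lt_trans h2)// ltrD2l.
by near: n; exact: near_infty_natSinv_lt (PosNum d0).
Unshelve. all: by end_near. Qed.

End RightEndpointApproximation.

Section ScalarDomination.
Context {R : realType}.
Local Notation mu := (@lebesgue_measure R).
Local Notation mset := (set (measurableTypeR R)).

(** Dominated convergence to zero, for nonnegative real functions. *)
Lemma dominated_cvgr0 (D : set R) (w : R -> R) (F : nat -> R -> R) :
  measurable (D : mset) ->
  measurable_fun (D : mset) w -> (\int[mu]_(r in D) (w r)%:E < +oo)%E ->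
  (forall n, measurable_fun (D : mset) (F n)) ->
  (forall n r, D r -> 0 <= F n r <= w r) ->
  (forall r, D r -> F n r @[n --> \oo] --> (0 : R)) ->
  (\int[mu]_(r in D) (F n r)%:E)%E @[n --> \oo] --> 0%E.
Proof.
move=> mD mw wfin mF Fw F0.
have w0 r : D r -> 0 <= w r.
  by move=> Dr; case/andP: (Fw 0%N _ Dr) => /le_trans; exact.
have iw : mu.-integrable D (EFin \o w).
  apply/integrableP; split; first exact/measurable_EFinP.
  rewrite (_ : (\int[mu]_(x in D) `|(EFin \o w) x|)%E = (\int[mu]_(r in D) (w r)%:E)%E)//.
  by apply: eq_integral => r; rewrite inE => Dr /=; rewrite ger0_norm ?w0.
have [||||| _ _] := @dominated_convergence _ _ _ mu D mD
  (fun n r => (F n r)%:E) (cst 0%E) (EFin \o w).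
- by move=> n; exact/measurable_EFinP.
- exact: measurable_cst.
- by apply: aeW => r Dr; apply: cvg_EFin; [exact: nearW|exact: F0].
- exact: iw.
- apply: aeW => r n Dr /=; have /andP[f0 fw] := Fw n r Dr.
  by rewrite lee_fin ger0_norm.
by rewrite integral0.
Qed.

End ScalarDomination.

Section Existence.
Context {R : realType} {X : completeNormedModType R[i]}.
Local Notation mu := (@lebesgue_measure R).
Local Notation mset := (set (measurableTypeR R)).

(** A right continuous function below a nonincreasing integrable one is
    integrable. *)
Lemma is_bochner_dominated (g : R -> X) (b : R -> R) :
  right_continuous g -> measurable_fun (`[0, +oo[ : mset) b ->
  (\int[mu]_(r in `[0%R, +oo[) (b r)%:E < +oo)%E ->
  (forall r r', 0 <= r -> r <= r' -> b r' <= b r) ->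
  (forall r, 0 <= r -> nrm (g r) <= b r) ->
  exists v, is_bochner `[0, +oo[ g v.
Proof.
move=> rg mb bfin bni gb.
have D0 (r : R) : `[0, +oo[%classic r -> 0 <= r by rewrite /= in_itv/= andbT.
have b0 r : 0 <= r -> 0 <= b r by move=> /gb; apply: le_trans; exact: nrm_ge0.
have cg r : `[0, +oo[%classic r -> step_fun (right_steps g n) r @[n --> \oo] --> g r.
  by move=> /D0; exact: right_steps_cvg.
apply: (@is_bochner_ex _ _ _ g (right_steps g)).
- exact: measurable_itv.
- by move=> n; exact: right_steps_simple.
- exact: aeW.
apply: (@dominated_cvgr0 _ _ (fun r => 2 * b r)).
- exact: measurable_itv.
- exact: measurable_funM.
- under eq_integral do rewrite EFinM.
  rewrite ge0_integralZl//; [|exact/measurable_EFinP|by move=> r /D0/b0].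
  by rewrite lte_mul_pinfty.
- have ms n := simple_on_measurable (@right_steps_simple _ _ g n).
  by move=> n; exact: measurable_nrm_limB ms (ms n) cg.
- move=> n r /D0 r0; rewrite nrm_ge0/= mulr_natl mulr2n.
  rewrite (le_trans (nrmD _ _))// lerD ?gb// nrmN.
  have [->|[r' rr' ->]] := right_steps_value g n r0; first by rewrite nrm0 b0.
  by rewrite (le_trans (gb _ _))// ?(le_trans r0)// bni.
- by move=> r Dr; under eq_fun do rewrite nrmB; apply/cvg_nrm0P; exact: cg.
Qed.

End Existence.

(** * Products with an integrable scalar kernel *)

Section ScalarKernel.
Context {R : realType}.
Local Notation mu := (@lebesgue_measure R).
Local Notation mset := (set (measurableTypeR R)).

Lemma integral_step_lty (X : normedModType R[i]) (D : set R) (s : seq (set R * X)) :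
  measurable (D : mset) -> simple_on D s ->
  (\int[mu]_(t in D) (nrm (step_fun s t))%:E < +oo)%E.
Proof.
move=> mD; elim: s => [_|[A y] s IH ss].
  by under eq_integral do rewrite step_fun_nil nrm0; rewrite integral0 ltry.
have [mA fA] := ss (A, y) (mem_head _ _); rewrite /= in mA fA.
have {}ss : simple_on D s by move=> p ps; apply: ss; rewrite inE ps orbT.
have ms := simple_on_measurable ss.
have mI : measurable_fun (D : mset) (fun t => nrm y * \1_A t : R).
  by apply: measurable_funM => //; exact: measurable_indic.
have mS : measurable_fun (D : mset) (fun t => nrm (step_fun s t) : R).
  under eq_fun do rewrite -[step_fun _ _]add0r.
  exact: measurable_nrm_step.
apply: (@le_lt_trans _ _ (\int[mu]_(t in D)
    ((nrm y * \1_A t)%:E + (nrm (step_fun s t))%:E))%E).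
  apply: ge0_integral_le => t Dt; first by rewrite lee_fin nrm_ge0.
  rewrite -EFinD lee_fin step_fun_cons (le_trans (nrmD _ _))// lerD2r indicE.
  by case: (t \in A); rewrite ?mulr1 ?mulr0 ?nrm0.
rewrite ge0_integralD//; last 4 first.
- by move=> t _; rewrite lee_fin mulr_ge0 ?nrm_ge0.
- exact/measurable_EFinP.
- by move=> t _; rewrite lee_fin nrm_ge0.
- exact/measurable_EFinP.
apply: lte_add_pinfty; last exact: IH.
under eq_integral do rewrite EFinM.
rewrite ge0_integralZl//; last 2 first.
- by apply/measurable_EFinP; exact: measurable_indic.
- by rewrite lee_fin nrm_ge0.
by rewrite integral_indic// lte_mul_pinfty ?lee_fin ?nrm_ge0// setIC.
Qed.

(** The modulus of a kernel agrees almost everywhere with a Borel weight. *)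
Lemma L1_weight (k : R -> R[i]) : L1_Rplus k ->
  exists w : R -> R, [/\ measurable_fun (`[0, +oo[ : mset) w, forall r, 0 <= w r,
    (\int[mu]_(r in `[0%R, +oo[) (w r)%:E = (L1_norm k)%:E)%E
    & {ae mu, forall r, `[0, +oo[%classic r -> w r = nrm (k r)}].
Proof.
move=> [v [s [ss [N [mN N0 sk]] Is _]]].
pose D : set R := `[0, +oo[%classic; pose E := D `\` N.
have mD : measurable (D : mset) by exact: measurable_itv.
have mE : measurable (E : mset) by exact: measurableD.
have ms n := simple_on_measurable (ss n).
have skE t : E t -> step_fun (s n) t @[n --> \oo] --> (k t : R[i]^o).
  move=> [Dt Nt]; apply: contrapT => nc; apply: Nt; apply: sk => /=.
  by move/(_ Dt).
have mk : measurable_fun (E : mset) (fun t => nrm (k t : R[i]^o) : R).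
  rewrite (_ : (fun _ => _) =
    fun t => nrm ((k t : R[i]^o) - step_fun ([::] : seq (set R * R[i]^o)) t)).
    exact: (@measurable_nrm_limB _ _ _ s).
  by apply/funext => t; rewrite step_fun_nil subr0.
(* One approximation within integral distance 1 bounds the integral of |k|. *)
have kfin : (\int[mu]_(t in D) (nrm (k t : R[i]^o))%:E < +oo)%E.
  have : \forall n \near \oo,
      (\int[mu]_(t in D) (nrm ((k t : R[i]^o) - step_fun (s n) t))%:E < 1%:E)%E.
    apply: (Is [set x : \bar R | (x < 1%:E)%E]); apply: open_nbhs_nbhs.
    by split; [exact: open_ereal_lt_ereal|rewrite /= lte_fin].
  move=> [n _ /(_ n (leqnn n))/= In].
  rewrite (@ge0_integral_setD_null _ _ _ mu D N)//; last first.
    by move=> t _; rewrite lee_fin nrm_ge0.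
  have sfin := integral_step_lty mD (ss n).
  rewrite (@ge0_integral_setD_null _ _ _ mu D N)// in sfin; last first.
    by move=> t _; rewrite lee_fin nrm_ge0.
  rewrite (@ge0_integral_setD_null _ _ _ mu D N)// in In; last first.
    by move=> t _; rewrite lee_fin nrm_ge0.
  rewrite -/E in sfin In *.
  apply: (@le_lt_trans _ _ (
    \int[mu]_(t in E) (nrm ((k t : R[i]^o) - step_fun (s n) t))%:E +
    \int[mu]_(t in E) (nrm (step_fun (s n) t))%:E +
    \int[mu]_(t in E) (nrm (0 : R[i]^o))%:E)%E).
    apply: integral_nrm_dist3 => //.
    - exact: (@measurable_nrm_limB _ _ _ s).
    - under eq_fun do rewrite -[step_fun _ _]add0r.
      exact: measurable_nrm_step.
    - move=> t _; rewrite nrm_ge0 nrm0 addr0/=.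
      by rewrite -{1}(subrK (step_fun (s n) t) (k t : R[i]^o)) nrmD.
  rewrite nrm0 integral_cst// mul0e adde0.
  by rewrite lte_add_pinfty// (lt_trans In)// ltry.
exists ((fun t => nrm (k t : R[i]^o)) \_ E); split.
- apply/(@measurable_restrict _ _ _ _ E D) => //.
  by rewrite setIidr//; exact: subDsetl.
- by move=> r; rewrite patchE; case: ifP => // _; exact: nrm_ge0.
- rewrite /L1_norm fineK; last first.
    rewrite ge0_fin_numE//; apply: integral_ge0 => t _.
    by rewrite lee_fin nrm_ge0.
  rewrite !(@ge0_integral_setD_null _ _ _ mu D N)//; last 2 first.
  + by move=> t _; rewrite lee_fin nrm_ge0.
  + by move=> t _; rewrite lee_fin patchE; case: ifP => // _; exact: nrm_ge0.
  by apply: eq_integral => r rE; rewrite patchE rE.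
- exists N; split => // r /= h; apply: contrapT => Nr; apply: h => Dr.
  by rewrite patchE ifT// inE.
Qed.

Variable X : completeNormedModType R[i].

(** Pointwise product of a scalar and a vector step function. *)
Definition step_mul (s : seq (set R * R[i]^o)) (s' : seq (set R * X)) :
    seq (set R * X) :=
  [seq (p.1 `&` q.1, (p.2 : R[i]) *: q.2) | p <- s, q <- s'].

Lemma step_fun_mul s s' t :
  step_fun (step_mul s s') t = (step_fun s t : R[i]) *: step_fun s' t.
Proof.
rewrite /step_fun big_allpairs_dep/= scaler_suml; apply: eq_bigr => p _.
rewrite scaler_sumr; apply: eq_bigr => q _.
rewrite indicI/= !scalerA; congr (_ *: _).
by rewrite rmorphM [X in _ = X * _]/(_ * _) mulrAC.
Qed.

Lemma step_mul_simple D s s' : measurable (D : mset) ->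
  simple_on D s -> simple_on D s' -> simple_on D (step_mul s s').
Proof.
move=> mD ss ss' _ /allpairsP[[p q] /= [/ss[mp fp] /ss'[mq fq] ->]] /=.
split; first exact: measurableI.
apply: le_lt_trans fp; rewrite le_measure ?inE//.
- by apply: measurableI => //; exact: measurableI.
- exact: measurableI.
- by apply: setIS; exact: subIsetl.
Qed.

(** The approximations are the products of those of [k], given by its
    integrability, with the right endpoint approximations of [u]. *)
Lemma is_bochner_kernel (k : R -> R[i]) (u : R -> X) (c : R) :
  L1_Rplus k -> right_continuous u -> (forall r, nrm (u r) <= c) ->
  exists v, is_bochner `[0, +oo[ (fun r => k r *: u r) v.
Proof.
move=> hk ru uc; have [w [mw w0 wE [N1 [mN1 N10 wk]]]] := L1_weight hk.
move: hk => [v [s [ss [N2 [mN2 N20 sk]] Is _]]].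
pose D : set R := `[0, +oo[%classic; pose N := N1 `|` N2; pose E := D `\` N.
have mN : measurable (N : mset) by exact: measurableU.
have N0 : mu N = 0%E by rewrite null_set_setU.
have mD : measurable (D : mset) by exact: measurable_itv.
have mE : measurable (E : mset) by exact: measurableD.
have D0 (r : R) : D r -> 0 <= r by rewrite /D/= in_itv/= andbT.
have c0 : 0 <= c by rewrite (le_trans _ (uc 0))// nrm_ge0.
have ms n := simple_on_measurable (ss n).
pose U := right_steps u.
have sU n : simple_on D (U n) by exact: right_steps_simple.
have mU n := simple_on_measurable (sU n).
have skE t : E t -> step_fun (s n) t @[n --> \oo] --> (k t : R[i]^o).
  move=> [Dt Nt]; apply: contrapT => nc; apply: Nt; right; apply: sk => /=.
  by move/(_ Dt).
have wkE t : E t -> w t = nrm (k t).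
  move=> [Dt Nt]; apply: contrapT => nc; apply: Nt; left; apply: wk => /=.
  by move/(_ Dt).
have Uu r : D r -> step_fun (U n) r @[n --> \oo] --> u r.
  by move=> /D0; exact: right_steps_cvg.
have Uc n r : D r -> nrm (step_fun (U n) r) <= c.
  move=> /D0 r0; have [->|[r' rr' ->]] := right_steps_value u n r0 => //.
  by rewrite nrm0.
have cvgE t : E t ->
    step_fun (step_mul (s n) (U n)) t @[n --> \oo] --> k t *: u t.
  move=> Et; under eq_fun do rewrite step_fun_mul.
  by apply: cvgZ; [exact: (skE t Et)|apply: Uu; case: Et].
apply: (@is_bochner_ex _ _ _ _ (fun n => step_mul (s n) (U n))) => //.
- by move=> n; exact: step_mul_simple.
- exists N; split => // t /= h; apply: contrapT => Nt; apply: h => Dt.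
  exact: cvgE.
have I2 : (\int[mu]_(r in D) (w r * nrm (u r - step_fun (U n) r))%:E)%E
    @[n --> \oo] --> 0%E.
  apply: (@dominated_cvgr0 _ _ (fun r => 2 * c * w r)) => //.
  - by apply: measurable_funM.
  - under eq_integral do rewrite EFinM.
    rewrite ge0_integralZl//; last 3 first.
    + exact/measurable_EFinP.
    + by move=> t _; rewrite lee_fin.
    + by rewrite lee_fin mulr_ge0.
    by rewrite wE lte_mul_pinfty// ?ltry// lee_fin mulr_ge0.
  - move=> n; apply: measurable_funM => //.
    exact: (@measurable_nrm_limB _ _ _ U).
  - move=> n r Dr; rewrite mulr_ge0 ?nrm_ge0//= mulrC ler_wpM2r//.
    by rewrite mulr_natl mulr2n (le_trans (nrmD _ _))// nrmN lerD// Uc.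
  - move=> r Dr; rewrite -[X in _ --> X](mulr0 (w r)); apply: cvgM => //.
      exact: cvg_cst.
    by under eq_fun do rewrite nrmB; apply/cvg_nrm0P; exact: Uu.
have I1 : (c%:E * \int[mu]_(t in D) (nrm ((k t : R[i]^o) - step_fun (s n) t))%:E)%E
    @[n --> \oo] --> 0%E.
  by rewrite -[X in _ --> X](mule0 c%:E); apply: cvgeZl.
have I12 : (c%:E * \int[mu]_(t in D) (nrm ((k t : R[i]^o) - step_fun (s n) t))%:E +
   \int[mu]_(r in D) (w r * nrm (u r - step_fun (U n) r))%:E)%E
    @[n --> \oo] --> 0%E.
  by rewrite -[X in _ --> X]adde0; apply: cvgeD.
apply: (squeeze_cvge _ (cvg_cst 0%E) I12); apply: nearW => n.
rewrite integral_ge0/=; last by move=> t _; rewrite lee_fin nrm_ge0.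
rewrite !(@ge0_integral_setD_null _ _ _ mu D N)//; last 3 first.
- by move=> t _; rewrite lee_fin mulr_ge0 ?nrm_ge0.
- by move=> t _; rewrite lee_fin nrm_ge0.
- by move=> t _; rewrite lee_fin nrm_ge0.
rewrite -/E.
have mks : measurable_fun (E : mset)
    (fun t => (nrm ((k t : R[i]^o) - step_fun (s n) t))%:E).
  by apply/measurable_EFinP; exact: (@measurable_nrm_limB _ _ _ s).
rewrite -ge0_integralZl//; last by move=> t _; rewrite lee_fin nrm_ge0.
rewrite -ge0_integralD//; last 4 first.
- by move=> t _; rewrite -EFinM lee_fin mulr_ge0 ?nrm_ge0.
- exact: emeasurable_funM.
- by move=> t _; rewrite lee_fin mulr_ge0 ?nrm_ge0.
- apply/measurable_EFinP; apply: measurable_funM => //.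
    by apply: measurable_funS mw => //; exact: subDsetl.
  by apply: (@measurable_nrm_limB _ _ _ U) => // t [Dt _]; exact: Uu.
apply: ge0_integral_le => t Et; first by rewrite lee_fin nrm_ge0.
rewrite -EFinM -EFinD lee_fin step_fun_mul wkE//.
rewrite (le_trans (nrm_dist _ (k t *: step_fun (U n) t) _))//.
rewrite -scalerBr -scalerBl !nrmZ addrC lerD2r mulrC ler_wpM2r ?nrm_ge0//.
by apply: Uc; case: Et.
Qed.

End ScalarKernel.

(** * Operators controlled by a weight *)

Section WeightedIntegral.
Context {R : realType}.
Local Notation mu := (@lebesgue_measure R).
Local Notation mset := (set (measurableTypeR R)).
Variables (w : R -> R) (W : R).
Hypothesis mw : measurable_fun (`[0, +oo[ : mset) w.
Hypothesis w0 : forall r, 0 <= w r.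
Hypothesis wW : (\int[mu]_(r in `[0%R, +oo[) (w r)%:E <= W%:E)%E.
Implicit Types F G H : R -> R.

(** Integral over the half-line against the weight [w]. *)
Definition wint F : R := fine (\int[mu]_(r in `[0%R, +oo[) (w r * F r)%:E)%E.

(** Bounded measurable nonnegative functions on the half-line. *)
Definition wbounded (c : R) F : Prop :=
  measurable_fun (`[0, +oo[ : mset) F /\ forall r, 0 <= F r <= c.

Lemma itv0yE (r : R) : `[0, +oo[%classic r = (0 <= r) :> Prop.
Proof. by rewrite /= in_itv/= andbT. Qed.

Lemma wint_le_cst c F : wbounded c F ->
  (\int[mu]_(r in `[0%R, +oo[) (w r * F r)%:E <= (W * c)%:E)%E.
Proof.
move=> [mF Fc]; have c0 : 0 <= c by have /andP[F0 /(le_trans F0)] := Fc 0.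
apply: (@le_trans _ _ (\int[mu]_(r in `[0%R, +oo[) (c%:E * (w r)%:E))%E).
  apply: ge0_integral_le => r _; have /andP[F0 Fcr] := Fc r.
    by rewrite lee_fin mulr_ge0.
  by rewrite -EFinM lee_fin mulrC ler_wpM2r.
rewrite ge0_integralZl//; last 2 first.
- exact/measurable_EFinP.
- by move=> r _; rewrite lee_fin.
by rewrite mulrC EFinM lee_wpmul2l// lee_fin.
Qed.

Lemma wint_fin c F : wbounded c F ->
  (\int[mu]_(r in `[0%R, +oo[) (w r * F r)%:E \is a fin_num)%E.
Proof.
move=> Fb; rewrite ge0_fin_numE.
  exact: le_lt_trans (wint_le_cst Fb) (ltry _).
by apply: integral_ge0 => r _; have [_ /(_ r)/andP[F0 _]] := Fb; rewrite lee_fin mulr_ge0.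
Qed.

Lemma wintE c F : wbounded c F ->
  (\int[mu]_(r in `[0%R, +oo[) (w r * F r)%:E = (wint F)%:E)%E.
Proof. by move=> /wint_fin/fineK. Qed.

Lemma wint_le c F : wbounded c F -> wint F <= W * c.
Proof. by move=> Fb; rewrite -lee_fin -(wintE Fb) wint_le_cst. Qed.

Lemma wint_leD c F G H : wbounded c F -> wbounded c G -> wbounded c H ->
  (forall r, F r <= G r + H r) -> wint F <= wint G + wint H.
Proof.
move=> Fb Gb Hb FGH; rewrite -lee_fin EFinD -(wintE Fb) -(wintE Gb) -(wintE Hb).
have [mF F0] := Fb; have [mG G0] := Gb; have [mH H0] := Hb.
rewrite -ge0_integralD//; last 4 first.
- by move=> r _; have /andP[? _] := G0 r; rewrite lee_fin mulr_ge0.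
- by apply/measurable_EFinP; exact: measurable_funM.
- by move=> r _; have /andP[? _] := H0 r; rewrite lee_fin mulr_ge0.
- by apply/measurable_EFinP; exact: measurable_funM.
apply: ge0_integral_le => r _.
  by have /andP[? _] := F0 r; rewrite lee_fin mulr_ge0.
by rewrite -EFinD lee_fin -mulrDr ler_wpM2l.
Qed.

Lemma wint_cvg0 c (F : nat -> R -> R) : (forall n, wbounded c (F n)) ->
  (forall r, F n r @[n --> \oo] --> (0 : R)) ->
  wint (F n) @[n --> \oo] --> (0 : R).
Proof.
move=> Fb F0; have c0 : 0 <= c.
  by have [_ /(_ 0)/andP[F00 /(le_trans F00)]] := Fb 0%N.
suff : (\int[mu]_(r in `[0%R, +oo[) (w r * F n r)%:E)%E @[n --> \oo] --> 0%E.
  by move/fine_cvg.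
apply: (@dominated_cvgr0 _ _ (fun r => c * w r)).
- exact: measurable_itv.
- exact: measurable_funM.
- under eq_integral do rewrite EFinM.
  rewrite ge0_integralZl//; last 2 first.
  + exact/measurable_EFinP.
  + by move=> r _; rewrite lee_fin.
  by rewrite lte_mul_pinfty ?lee_fin// (le_lt_trans wW) ?ltry.
- by move=> n; apply: measurable_funM => //; case: (Fb n).
- move=> n r _; have [_ /(_ r)/andP[f0 fc]] := Fb n.
  by rewrite mulr_ge0//= mulrC ler_wpM2r.
- by move=> r _; rewrite -[X in _ --> X](mulr0 (w r)); apply: cvgM => //; exact: cvg_cst.
Qed.

End WeightedIntegral.

Section Convolution.
Context {R : realType} {X : completeNormedModType R[i]}.
Local Notation mu := (@lebesgue_measure R).
Local Notation mset := (set (measurableTypeR R)).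
Local Notation BC := (@bounded_continuous R X R).

(** An operator behaving like a convolution on the half-line with an operator
    kernel of norm at most [w]: distances of values are controlled by the
    weighted distances of the histories. *)
Definition convolution_like (w : R -> R) (W : R) (J : (R -> X) -> R -> X) : Prop :=
  [/\ measurable_fun (`[0, +oo[ : mset) w, forall r, 0 <= w r,
      (\int[mu]_(r in `[0%R, +oo[) (w r)%:E <= W%:E)%E
    & forall u v, BC u -> BC v -> forall t t',
      ((nrm (J u t - J v t'))%:E <=
       \int[mu]_(r in `[0%R, +oo[) (w r * nrm (u (t - r)%R - v (t' - r)%R))%:E)%E].

Lemma continuous_shift (u : R -> X) t : continuous u -> continuous (fun r => u (t - r)).
Proof.
move=> cu r; apply: (@continuous_comp _ _ _ (fun r => t - r) u); last exact: cu.
by apply: cvgB; [exact: cvg_cst|exact: cvg_id].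
Qed.

Lemma measurable_dist_shift (D : set R) (u v : R -> X) t t' :
  measurable (D : mset) -> continuous u -> continuous v ->
  measurable_fun (D : mset) (fun r => nrm (u (t - r) - v (t' - r)) : R).
Proof.
move=> mD cu cv; apply: (@measurable_funS _ _ _ _ setT) => //.
apply: continuous_measurable_fun => r; apply: cvg_nrm.
by apply: cvgB; exact: continuous_shift.
Qed.

Lemma wbounded_dist_shift (u v : R -> X) c c' t t' : continuous u -> continuous v ->
  (forall r, nrm (u r) <= c) -> (forall r, nrm (v r) <= c') ->
  wbounded (c + c') (fun r => nrm (u (t - r) - v (t' - r))).
Proof.
move=> cu cv uc vc; split; first exact: measurable_dist_shift.
by move=> r; rewrite nrm_ge0 (le_trans (nrmD _ _))// nrmN lerD.
Qed.

Variables (w : R -> R) (W : R) (J : (R -> X) -> R -> X).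
Hypothesis wJ : convolution_like w W J.

Lemma conv_dist u v t t' : BC u -> BC v ->
  nrm (J u t - J v t') <= wint w (fun r => nrm (u (t - r) - v (t' - r))).
Proof.
move=> bu bv; have [mw w0 wW /(_ u v bu bv t t')] := wJ.
have [cu [c uc]] := bu; have [cv [c' vc]] := bv.
by rewrite (wintE mw w0 wW (wbounded_dist_shift t t' cu cv uc vc)) lee_fin.
Qed.

Lemma conv_lip u v c t : BC u -> BC v -> (forall r, nrm (u r - v r) <= c) ->
  nrm (J u t - J v t) <= W * c.
Proof.
move=> bu bv uvc; apply: le_trans (conv_dist _ _ bu bv) _.
have [mw w0 wW _] := wJ; apply: wint_le => //; split.
  by apply: measurable_dist_shift => //; [case: bu|case: bv].
by move=> r; rewrite nrm_ge0/=.
Qed.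

Lemma conv_bc u : BC u -> BC (J u).
Proof.
move=> bu; have [cu [c uc]] := bu; have [mw w0 wW _] := wJ.
have Fb t t' := wbounded_dist_shift t t' cu cu uc uc.
split; last first.
  exists (W * (c + c) + nrm (J u 0)) => t.
  rewrite -[J u t](subrK (J u 0)) (le_trans (nrmD _ _))// lerD2r.
  apply: le_trans (conv_dist _ _ bu bu) _.
  exact: wint_le.
move=> t; apply/cvg_nrm0P.
apply/(@cvg_nbhsP _ R^o (fun x => nrm (J u x - J u t))) => x xt.
apply: (@squeeze_cvgr _ _ _ _ (cst 0)
  (fun n => wint w (fun r => nrm (u (x n - r) - u (t - r))))); last 2 first.
- exact: cvg_cst.
- apply: (wint_cvg0 mw w0 wW (fun n => Fb (x n) t)) => r; apply/cvg_nrm0P.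
  apply: (@cvg_comp _ _ _ (fun n => x n - r) u _ (nbhs (t - r))); last exact: cu.
  by apply: cvgB => //; exact: cvg_cst.
- by apply: nearW => n; rewrite nrm_ge0 conv_dist.
Qed.

Lemma conv_C0 u v : BC u -> BC v -> nrm (u t - v t) @[t --> +oo] --> (0 : R) ->
  nrm (J u t - J v t) @[t --> +oo] --> (0 : R).
Proof.
move=> bu bv uv0; have [cu [c uc]] := bu; have [cv [c' vc]] := bv.
have [mw w0 wW _] := wJ; have Fb t t' := wbounded_dist_shift t t' cu cv uc vc.
apply/cvg_pinftyP => x xoo.
apply: (@squeeze_cvgr _ _ _ _ (cst 0)
  (fun n => wint w (fun r => nrm (u (x n - r) - v (x n - r))))); last 2 first.
- exact: cvg_cst.
- apply: (wint_cvg0 mw w0 wW (fun n => Fb (x n) (x n))) => r.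
  apply: ((cvg_pinftyP (fun t => nrm (u t - v t)) 0).1 uv0 (fun n => x n - r)).
  apply/cvgryPge => A; move/cvgryPge : xoo => /(_ (A + r)).
  by apply: filterS => n; rewrite lerBrDr.
- by apply: nearW => n; rewrite nrm_ge0 conv_dist.
Qed.

(** The limit of the translates of [J u] is not written as a convolution of the
    limit [psi] of the translates of [u]: the values are shown to be Cauchy, and
    the limit is compared with [J u] through weighted integrals of real functions
    only. *)
Lemma conv_AA u : AA u -> AA (J u).
Proof.
move=> [bu uAA]; split; first exact: conv_bc.
have [cu [c uc]] := bu; have [mw w0 wW _] := wJ.
move=> s; have [e [ie [psi he]]] := uAA s; exists e; split => //.
have u_psi t : u (t + s (e n)) @[n --> \oo] --> psi t by have [] := he t.
have psi_u t : psi (t - s (e n)) @[n --> \oo] --> u t by have [] := he t.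
have psic t : nrm (psi t) <= c.
  by apply: nrm_lim_le (u_psi t); exact: nearW.
(* psi need not be continuous: measurability comes from the convergence. *)
have Fb t t' : wbounded (c + c) (fun r => nrm (u (t - r) - psi (t' - r))).
  split.
    apply: (@measurable_fun_cvg _ (measurableTypeR R) R _
        (fun m r => nrm (u (t - r) - u (t' + s (e m) - r)))
        (fun r => nrm (u (t - r) - psi (t' - r)))).
      by move=> m; exact: measurable_dist_shift.
    move=> r _; apply: cvg_nrm; apply: cvgB; first exact: cvg_cst.
    by under eq_fun do rewrite addrAC; exact: u_psi.
  by move=> r; rewrite nrm_ge0 (le_trans (nrmD _ _))// nrmN lerD.
pose a t n := wint w (fun r => nrm (u (t + s (e n) - r) - psi (t - r))).
have a0 t : a t n @[n --> \oo] --> (0 : R).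
  apply: (wint_cvg0 mw w0 wW (fun n => Fb _ t)) => r; apply/cvg_nrm0P.
  by under eq_fun do rewrite addrAC; exact: u_psi.
have /choice[phi Jphi] : forall t : R, exists y : X, J u (t + s (e n)) @[n --> \oo] --> y.
  move=> t; apply: cauchy_nrm_cvg => d d0.
  have d20 : 0 < d / 2 by rewrite divr_gt0.
  have [N _ hN] := cvgr_lt _ (a0 t) _ d20.
  exists N => m n /hN/= am /hN/= an.
  rewrite (splitr d) (le_lt_trans _ (ltrD am an))//.
  apply: le_trans (conv_dist _ _ bu bu) _.
  apply: (wint_leD mw w0 wW (wbounded_dist_shift _ _ cu cu uc uc) (Fb _ _) (Fb _ _)).
  by move=> r; rewrite [X in _ <= _ + X]nrmB; exact: nrm_dist.
exists phi => t; split; first exact: Jphi.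
(* The distance of phi (t - s (e n)) and J u t is at most b n, because
   J u (t - s (e n) + s (e m)) tends to the former as m grows. *)
pose b n := wint w (fun r => nrm (u (t - r) - psi (t - s (e n) - r))).
have b0 : b n @[n --> \oo] --> (0 : R).
  apply: (wint_cvg0 mw w0 wW (fun n => Fb t _)) => r.
  under eq_fun do rewrite nrmB addrAC.
  by apply/cvg_nrm0P; exact: psi_u.
apply: cvg_nrm_le b0; apply: nearW => n.
apply/ler_addgt0Pr => d d0.
have [N _ /(_ N (leqnn N))/= aN] : \forall m \near \oo,
    a (t - s (e n)) m < d / 2 /\
    nrm (J u (t - s (e n) + s (e m)) - phi (t - s (e n))) < d / 2.
  apply: filterI; first exact: (cvgr_lt _ (a0 _) _ (divr_gt0 d0 _)).
  by move: (Jphi (t - s (e n))) => /cvg_nrmP; apply; rewrite divr_gt0.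
move: aN => [aN JN].
rewrite (le_trans (nrm_dist _ (J u (t - s (e n) + s (e N))) _))// nrmB.
rewrite (splitr d) addrA addrC lerD ?(ltW JN)//.
apply: le_trans (conv_dist _ _ bu bu) _.
rewrite addrC (le_trans _ (lerD (ltW aN) (lexx (b n))))//.
apply: (wint_leD mw w0 wW (wbounded_dist_shift _ _ cu cu uc uc) (Fb _ _) (Fb _ _)).
by move=> r; rewrite [X in _ <= _ + X]nrmB; exact: nrm_dist.
Qed.

End Convolution.

(** * The two convolutions *)

Section ConvolutionOperators.
Context {R : realType} {X : completeNormedModType R[i]}.
Local Notation mu := (@lebesgue_measure R).
Local Notation mset := (set (measurableTypeR R)).
Local Notation BC := (@bounded_continuous R X R).

Lemma continuous_near (u : R -> X) r e : continuous u -> 0 < e ->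
  exists2 d, 0 < d & forall x, `|x - r| < d -> nrm (u x - u r) < e.
Proof.
move=> /(_ r)/cvg_nrmP h /h /nbhs_ballP[d /= d0 hd]; exists d => // x xr.
by apply: hd; rewrite /ball/= distrC.
Qed.

Lemma continuous_right_continuous (u : R -> X) : continuous u -> right_continuous u.
Proof.
move=> cu r _ e e0; have [d d0 hd] := continuous_near r cu e0.
exists d => // x /andP[rx xd]; apply: hd.
by rewrite ger0_norm; lra.
Qed.

Lemma K_op_bochner k (u : R -> X) t : L1_Rplus k -> BC u ->
  is_bochner `[0, +oo[ (fun r => k r *: u (t - r)) (K_op k u t).
Proof.
move=> hk [cu [c uc]].
have ru : right_continuous (fun r => u (t - r)).
  exact/continuous_right_continuous/continuous_shift.
have [v hv] := is_bochner_kernel hk ru (fun r => uc (t - r)).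
suff -> : K_op k u t = v by [].
rewrite /K_op; apply: bochner_intE; first exact: measurable_itv.
have := is_bochner_reflect t hv; congr is_bochner.
by apply/funext => s; rewrite subKr.
Qed.

Lemma convolution_like_K k : L1_Rplus k ->
  exists w, convolution_like w (L1_norm k) (K_op k : (R -> X) -> R -> X).
Proof.
move=> hk; have [w [mw w0 wE [N [mN N0 wk]]]] := L1_weight hk.
exists w; split => //; first by rewrite wE.
move=> u v bu bv t t'.
apply: (le_trans (bochner_dist (measurable_itv _) (K_op_bochner t hk bu)
  (K_op_bochner t' hk bv))).
rewrite (@ge0_integral_setD_null _ _ _ mu _ N)//; last first.
  by move=> r _; rewrite lee_fin nrm_ge0.
rewrite [leRHS](@ge0_integral_setD_null _ _ _ mu _ N)//; last first.
  by move=> r _; rewrite lee_fin mulr_ge0 ?nrm_ge0.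
apply: ge0_integral_le => r [Dr Nr]; first by rewrite lee_fin nrm_ge0.
rewrite -scalerBr nrmZ lee_fin; suff -> : w r = nrm (k r) by [].
by apply: contrapT => nc; apply: Nr; apply: wk => /=; move/(_ Dr).
Qed.

(** Convolution of the past of [h] with the family of operators [S]. *)
Definition op_conv (S : R -> X -> X) (h : R -> X) (t : R) : X :=
  bochner_int `]-oo, t[ (fun s => S (t - s) (h s)).

Variables (S : R -> X -> X) (b : R -> R) (W : R).
Hypothesis hS : strongly_continuous_family S.
Hypothesis mb : measurable_fun (`[0, +oo[ : mset) b.
Hypothesis bW : (\int[mu]_(r in `[0%R, +oo[) (b r)%:E <= W%:E)%E.
Hypothesis b0 : forall r, 0 <= b r.
Hypothesis bni : forall r r', 0 <= r -> r <= r' -> b r' <= b r.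
Hypothesis Sb : forall r, 0 <= r -> forall x, nrm (S r x) <= b r * nrm x.

Lemma op_subr r x y : 0 <= r -> S r (x - y) = S r x - S r y.
Proof.
move=> r0; have [lS _] := hS.1 r r0.
by rewrite addrC -scaleN1r lS scaleN1r addrC.
Qed.

Lemma right_continuous_op (h : R -> X) t : continuous h ->
  right_continuous (fun r => S r (h (t - r))).
Proof.
move=> ch r r0 e e0; pose beta := b 0 + 1.
have beta0 : 0 < beta by rewrite ltr_wpDl.
have e20 : 0 < e / 2 by rewrite divr_gt0.
(* S x (h (t - x)) - S r (h (t - r)) is split through S x (h (t - r)): the first
   part is controlled by the uniform bound beta, the second by strong continuity. *)
have [d d0 hd] := continuous_near (t - r) ch (divr_gt0 e20 beta0).
have /subspace_continuousP/(_ r) := hS.2 (h (t - r)).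
rewrite /= in_itv/= andbT => /(_ r0)/cvg_nrmP/(_ _ e20).
rewrite near_withinE => /nbhs_ballP[d' /= d'0 hd'].
exists (Num.min d d'); first by rewrite lt_min d0 d'0.
move=> x /andP[rx]; rewrite -ltrBlDl lt_min => /andP[xd xd'].
have x0 : 0 <= x := le_trans r0 rx.
rewrite -[S x _](subrK (S x (h (t - r)))) -addrA.
rewrite (le_lt_trans (nrmD _ _))// (splitr e) ltr_leD//; last first.
  apply/ltW/hd'; last by rewrite /= in_itv/= andbT.
  by rewrite /ball/= distrC ger0_norm ?subr_ge0.
rewrite -op_subr// (le_lt_trans (Sb x0 _))//.
apply: (@le_lt_trans _ _ (beta * nrm (h (t - x) - h (t - r)))).
  rewrite ler_wpM2r ?nrm_ge0// (le_trans (bni (lexx 0) x0))//.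
  by rewrite /beta lerDl.
rewrite -ltr_pdivlMl// mulrC; apply: hd.
by rewrite (_ : t - x - (t - r) = r - x) ?ler0_norm; lra.
Qed.

Lemma op_bochner (h : R -> X) t : BC h ->
  exists v, is_bochner `[0, +oo[ (fun r => S r (h (t - r))) v.
Proof.
move=> [ch [c hc]].
have c0 : 0 <= c by rewrite (le_trans _ (hc 0))// nrm_ge0.
apply: (@is_bochner_dominated _ _ _ (fun r => b r * c)).
- exact: right_continuous_op.
- exact: measurable_funM.
- under eq_integral do rewrite EFinM muleC.
  rewrite ge0_integralZl//; last 2 first.
  + exact/measurable_EFinP.
  + by move=> r _; rewrite lee_fin.
  by rewrite lte_mul_pinfty ?lee_fin// (le_lt_trans bW) ?ltry.
- by move=> r r' r0 rr'; rewrite ler_wpM2r// bni.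
- by move=> r r0; rewrite (le_trans (Sb r0 _))// ler_wpM2l.
Qed.

Lemma op_bochner_conv (h : R -> X) t v :
  is_bochner `[0, +oo[ (fun r => S r (h (t - r))) v ->
  is_bochner `]-oo, t[ (fun s => S (t - s) (h s)) v.
Proof.
move=> /(is_bochner_reflect t); congr is_bochner.
by apply/funext => s; rewrite subKr.
Qed.

Lemma op_conv_integrable (h : R -> X) t : BC h ->
  bochner_integrable `]-oo, t[ (fun s => S (t - s) (h s)).
Proof. by move=> /(op_bochner t)[v /op_bochner_conv hv]; exists v. Qed.

Lemma op_conv_bochner (h : R -> X) t : BC h ->
  is_bochner `[0, +oo[ (fun r => S r (h (t - r))) (op_conv S h t).
Proof.
move=> /(op_bochner t)[v hv]; suff -> : op_conv S h t = v by [].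
by apply: bochner_intE; [exact: measurable_itv|exact: op_bochner_conv].
Qed.

Lemma convolution_like_op : convolution_like b W (op_conv S).
Proof.
split => // u v bu bv t t'.
apply: (le_trans (bochner_dist (measurable_itv _) (op_conv_bochner t bu)
  (op_conv_bochner t' bv))).
apply: ge0_integral_le => r; rewrite itv0yE => r0.
  by rewrite lee_fin nrm_ge0.
by rewrite -op_subr// lee_fin Sb.
Qed.

End ConvolutionOperators.

(** * Uniform limits, diagonal extraction and fixed points *)

Section UniformLimits.
Context {R : realType} {X : completeNormedModType R[i]}.
Local Notation BC := (@bounded_continuous R X R).
Implicit Types (u v : R -> X) (P : (R -> X) -> Prop).

(** [u] is a uniform limit of members of [P]. *)
Definition uniform_limit P u : Prop :=
  forall e : R, 0 < e -> exists2 v, P v & forall t, nrm (v t - u t) <= e.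

Lemma uniform_limit_bc u : uniform_limit BC u -> BC u.
Proof.
move=> hu; split; last first.
  have [v [_ [c vc]] vu] := hu 1 ltr01; exists (1 + c) => t.
  rewrite -[u t](subrK (v t)) (le_trans (nrmD _ _))// lerD//.
  by rewrite nrmB.
move=> t; apply/cvg_nrmP => e e0.
have e30 : 0 < e / 3 by rewrite divr_gt0.
have [v [cv _] vu] := hu _ e30.
have /cvg_nrmP/(_ _ e30) := cv t; apply: filterS => s vst.
rewrite (le_lt_trans (nrm_dist _ (v s) _))//.
  rewrite (le_lt_trans (lerD (lexx _) (nrm_dist _ (v t) _)))//.
by move: (vu s) (vu t) vst; rewrite (nrmB (u s)); lra.
Qed.

(** Closedness under uniform limits of the functions asymptotic to [w]. *)
Lemma uniform_limit_C0 (w : R -> X) u :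
  uniform_limit (fun v => BC v /\ nrm (v t - w t) @[t --> +oo] --> (0 : R)) u ->
  BC u /\ nrm (u t - w t) @[t --> +oo] --> (0 : R).
Proof.
move=> hu; split.
  by apply: uniform_limit_bc => e /hu[v [bv _] vu]; exists v.
apply/cvgr0Pnorm_lt => e e0; have e20 : 0 < e / 2 by rewrite divr_gt0.
have [v [_ /cvgr0Pnorm_lt/(_ _ e20) vw] vu] := hu _ e20.
apply: filterS vw => t; rewrite !ger0_norm ?nrm_ge0// => vw.
rewrite (le_lt_trans (nrm_dist _ (v t) _))// (splitr e) ler_ltD//.
by rewrite nrmB.
Qed.

Lemma homo_ltn_le (e : nat -> nat) : {homo e : m n / (m < n)%N} -> forall n, (n <= e n)%N.
Proof. by move=> ie; elim=> // n IH; rewrite (leq_ltn_trans IH)// ie. Qed.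

(** Diagonal extraction: countably many properties, each inherited by sequences
    that are eventually extracted from one having it, and each obtainable by
    extraction, hold together along one extraction. *)
Lemma diagonal_extraction (P : nat -> (nat -> nat) -> Prop) :
  (forall j e, {homo e : m n / (m < n)%N} -> exists e',
     {homo e' : m n / (m < n)%N} /\ P j (e \o e')) ->
  (forall j e e', P j e ->
     (exists N, forall n, (N <= n)%N -> exists2 m, (n <= m)%N & e' n = e m) ->
     P j e') ->
  exists2 e, {homo e : m n / (m < n)%N} & forall j, P j e.
Proof.
move=> Pex Pst.
have next (j : nat) (e : {e | {homo e : m n / (m < n)%N}}) :
    {e' : nat -> nat | {homo e' : m n / (m < n)%N} /\ P j (sval e \o e')}.
  by apply: cid; apply: Pex; exact: svalP e.
pose ext j e := sval (next j e).
have extP j e := svalP (next j e).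
have homo_comp (e e' : nat -> nat) : {homo e : m n / (m < n)%N} ->
    {homo e' : m n / (m < n)%N} -> {homo e \o e' : m n / (m < n)%N}.
  by move=> h h' m n mn /=; apply: h; apply: h'.
have homo_id : {homo id : m n / (m < n)%N} by [].
pose step j (e : {e | {homo e : m n / (m < n)%N}}) :
    {e | {homo e : m n / (m < n)%N}} :=
  exist _ (sval e \o ext j e) (homo_comp _ _ (svalP e) (extP j e).1).
(* E j has the properties 0, ..., j; the diagonal n |-> E n n is, from the index j
   on, extracted from E j. *)
pose E := fix E j : {e | {homo e : m n / (m < n)%N}} :=
  if j is i.+1 then step i.+1 (E i) else step 0%N (exist _ id homo_id).
have stepP j e : P j (sval (step j e)) := (extP j e).2.
have EP j : P j (sval (E j)) by case: j => [|j]; exact: stepP.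
have Etail j k i : exists2 m, (i <= m)%N & sval (E (j + k)%N) i = sval (E j) m.
  elim: k i => [|k IH] i; first by exists i; rewrite ?addn0.
  have [m im Em] := IH (ext (j + k).+1 (E (j + k)%N) i).
  exists m; last by rewrite -Em addnS.
  by apply: leq_trans im; apply: homo_ltn_le; exact: (extP _ _).1.
exists (fun n => sval (E n) n).
  apply: homo_ltn; first by move=> ? ? ?; exact: ltn_trans.
  move=> n /=; apply: (svalP (E n)).
  by apply: leq_trans (homo_ltn_le (extP _ _).1 n.+1).
move=> j; apply: (Pst j _ _ (EP j)); exists j => n jn.
by have [m nm] := Etail j (n - j)%N n; rewrite subnKC// => Em; exists m.
Qed.

Lemma cvg_eventually_extracted (x : nat -> X) (l : X) (e e' : nat -> nat) :
  (exists N, forall n, (N <= n)%N -> exists2 m, (n <= m)%N & e' n = e m) ->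
  x (e n) @[n --> \oo] --> l -> x (e' n) @[n --> \oo] --> l.
Proof.
move=> [N hN] /cvg_nrmP xl; apply/cvg_nrmP => d /xl[M _ hM].
exists (maxn N M) => // n /=; rewrite geq_max => /andP[/hN[m nm ->] Mn].
by apply: hM => /=; exact: leq_trans nm.
Qed.

(** One extraction serves all the approximations [v j]; their limits [psi j] then
    converge uniformly. *)
Lemma uniform_limit_AA u : uniform_limit AA u -> AA u.
Proof.
move=> hu; split; first by apply: uniform_limit_bc => e /hu[v [bv _] vu]; exists v.
move=> s.
have /choice[v vP] : forall j : nat, exists v, AA v /\
    forall t, nrm (v t - u t) <= j.+1%:R^-1.
  by move=> j; have [|v Av vu] := hu j.+1%:R^-1; [rewrite invr_gt0|exists v].
have vu j t : nrm (v j t - u t) <= j.+1%:R^-1 by have [_] := vP j; exact.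
have [e ie he] := @diagonal_extraction
  (fun j e => exists psi : R -> X, forall t,
      v j (t + s (e n)) @[n --> \oo] --> psi t /\
      psi (t - s (e n)) @[n --> \oo] --> v j t)
  (fun j e _ => (vP j).1.2 (s \o e))
  (fun j e e' H tail => let: ex_intro psi hpsi := H in ex_intro _ psi (fun t =>
     conj (@cvg_eventually_extracted (fun m => v j (t + s m)) _ e e' tail (hpsi t).1)
          (@cvg_eventually_extracted (fun m => psi (t - s m)) _ e e' tail (hpsi t).2))).
exists e; split => //.
have {he}/choice[psi he] := he.
have inv0 d : 0 < d -> exists j : nat, j.+1%:R^-1 < d :> R.
  move=> d0; have := near_infty_natSinv_lt (PosNum d0).
  by move=> [N _ /(_ N (leqnn N)) h]; exists N.
have psiB i j t : nrm (psi i t - psi j t) <= i.+1%:R^-1 + j.+1%:R^-1.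
  apply: (@nrm_lim_le _ _ _ \oo _ (fun n => v i (t + s (e n)) - v j (t + s (e n)))).
    apply: nearW => n; rewrite (le_trans (nrm_dist _ (u (t + s (e n))) _))//.
    by rewrite lerD ?vu// nrmB vu.
  by apply: cvgB; [have [] := he i t|have [] := he j t].
have /choice[phi phiP] : forall t : R, exists y : X, psi n t @[n --> \oo] --> y.
  move=> t; apply: cauchy_nrm_cvg => d d0.
  have [N hN] := inv0 _ (divr_gt0 d0 (ltr0Sn R 1)).
  exists N => m n Nm Nn; apply: le_lt_trans (psiB m n t) _.
  rewrite (splitr d); apply: ltrD; apply: le_lt_trans hN;
    by rewrite lef_pV2 ?posrE// ler_nat.
have psi_phi j t : nrm (psi j t - phi t) <= j.+1%:R^-1.
  apply/ler_addgt0Pr => d d0; have [N hN] := inv0 _ d0.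
  apply: (@nrm_lim_le _ _ _ \oo _ (fun n => psi j t - psi n t)).
    exists N => // n /= Nn; rewrite (le_trans (psiB _ _ _))// lerD2l.
    by rewrite (le_trans _ (ltW hN))// lef_pV2 ?posrE// ler_nat.
  by apply: cvgB => //; exact: cvg_cst.
exists phi => t; split; apply/cvg_nrmP => d d0;
  have d30 : 0 < d / 3 by rewrite divr_gt0.
- have [j hj] := inv0 _ d30.
  have [/cvg_nrmP/(_ _ d30) + _] := he j t; apply: filterS => n hn.
  rewrite (le_lt_trans (nrm_dist _ (v j (t + s (e n))) _))//.
  rewrite (le_lt_trans (lerD (lexx _) (nrm_dist _ (psi j t) _)))//.
  rewrite nrmB; move: (vu j (t + s (e n))) (psi_phi j t) hn hj.
  by move: (j.+1%:R^-1) => q; lra.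
- have [j hj] := inv0 _ d30.
  have [_ /cvg_nrmP/(_ _ d30)] := he j t; apply: filterS => n hn.
  rewrite (le_lt_trans (nrm_dist _ (psi j (t - s (e n))) _))//.
  rewrite (le_lt_trans (lerD (lexx _) (nrm_dist _ (v j t) _)))//.
  rewrite nrmB; move: (vu j t) (psi_phi j (t - s (e n))) hn hj.
  by move: (j.+1%:R^-1) => q; lra.
Qed.

(** Banach's fixed point theorem for the supremum distance, in a class of
    bounded functions closed under uniform limits. *)
Lemma contraction_fixpoint P (G : (R -> X) -> R -> X) (L : R) u0 :
  0 <= L -> L < 1 -> P u0 -> (forall u, P u -> P (G u)) -> (forall u, P u -> BC u) ->
  (forall u v c, P u -> P v -> (forall t, nrm (u t - v t) <= c) ->
     forall t, nrm (G u t - G v t) <= L * c) ->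
  (forall u, uniform_limit P u -> P u) ->
  exists2 u, P u & forall t, G u t = u t.
Proof.
move=> L0 L1 Pu0 PG Pbc Gc Pcl.
pose x n := iter n G u0.
have Px n : P (x n) by elim: n => //= n; exact: PG.
have [c c0 hc] : exists2 c, 0 <= c & forall t, nrm (x 0%N t - x 1%N t) <= c.
  have [_ [c hc]] := Pbc _ (Px 0%N); have [_ [c' hc']] := Pbc _ (Px 1%N).
  exists (c + c').
    rewrite addr_ge0 ?(le_trans (nrm_ge0 _) (hc 0))//.
    exact: le_trans (nrm_ge0 _) (hc' 0).
  by move=> t; rewrite (le_trans (nrmD _ _))// nrmN lerD.
have L10 : 0 < 1 - L by rewrite subr_gt0.
have xS n t : nrm (x n t - x n.+1 t) <= L ^+ n * c.
  elim: n t => [|n IH] t; first by rewrite mul1r.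
  by rewrite exprS -mulrA; apply: Gc; [exact: Px|exact: (Px n.+1)|exact: IH].
(* B n is the tail of the geometric series bounding the distances. *)
pose B n := L ^+ n * c / (1 - L).
have B0 : B n @[n --> \oo] --> (0 : R).
  have -> : (0 : R) = 0 * c / (1 - L) by rewrite !mul0r.
  apply: cvgM; last exact: cvg_cst.
  apply: cvgM; last exact: cvg_cst.
  by apply: cvg_expr; rewrite ger0_norm.
have BE n : L ^+ n * c = B n - B n.+1.
  by rewrite /B exprS -mulrBl; field; rewrite gt_eqF.
have Bge0 n : 0 <= B n by rewrite /B divr_ge0 ?(ltW L10)// mulr_ge0// exprn_ge0.
have xD n m t : nrm (x n t - x (n + m)%N t) <= B n - B (n + m)%N.
  elim: m => [|m IH]; first by rewrite addn0 !subrr nrm0.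
  rewrite addnS (le_trans (nrm_dist _ (x (n + m)%N t) _))//.
  by move: IH (xS (n + m)%N t); rewrite BE; lra.
have xB n m t : (n <= m)%N -> nrm (x n t - x m t) <= B n.
  move=> nm; rewrite -(subnKC nm) (le_trans (xD _ _ _))// lerBlDr lerDl.
  exact: Bge0.
have /choice[u xu] : forall t : R, exists y : X, x n t @[n --> \oo] --> y.
  move=> t; apply: cauchy_nrm_cvg => d d0; have d20 : 0 < d / 2 by rewrite divr_gt0.
  have [N _ /(_ N (leqnn N))/= hN] := cvgr_lt _ B0 _ d20.
  exists N => m n Nm Nn; rewrite (le_lt_trans (nrm_dist _ (x N t) _))//.
  by rewrite nrmB (splitr d) ltrD// (le_lt_trans (xB _ _ _ _)).
have xuB n t : nrm (x n t - u t) <= B n.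
  apply: (@nrm_lim_le _ _ _ \oo _ (fun m => x n t - x m t)).
    by exists n => // m /= nm; exact: xB.
  by apply: cvgB; [exact: cvg_cst|exact: xu].
have Pu : P u.
  apply: Pcl => e e0; have [N _ /(_ N (leqnn N))/= hN] := cvgr_lt _ B0 _ e0.
  by exists (x N) => // t; exact: le_trans (xuB N t) (ltW hN).
exists u => // t; apply/eqP; rewrite -subr_eq0; apply/eqP/nrm0_eq0.
apply/eqP; rewrite eq_le nrm_ge0 andbT; apply/ler_addgt0Pr => e e0.
rewrite add0r; have e20 : 0 < e / 2 by rewrite divr_gt0.
have [N _ hN] := cvgr_lt _ B0 _ e20.
rewrite (le_trans (nrm_dist _ (x N.+1 t) _))// (splitr e).
have bN := hN N (leqnn N); have bN1 := hN N.+1 (leqnSn N).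
rewrite lerD ?(le_trans (xuB _ _) (ltW bN1))//.
apply: (@le_trans _ _ (L * B N)).
  by apply: Gc => // r; rewrite nrmB.
apply: le_trans (ltW bN); rewrite -[leRHS]mul1r ler_wpM2r// ltW//.
Qed.

End UniformLimits.

(** * Almost automorphic functions and superposition *)

Section AlmostAutomorphicRange.
Context {R : realType} {X : completeNormedModType R[i]}.
Implicit Types (u v : R -> X).

Lemma AA_totally_bounded u e : AA u -> 0 < e ->
  exists l : seq R, forall t, exists2 t', t' \in l & nrm (u t - u t') < e.
Proof.
move=> [_ uAA] e0; apply: contrapT => nl.
have /choice[f fP] : forall l : seq R, exists t, forall t', t' \in l ->
    e <= nrm (u t - u t').
  move=> l; apply: contrapT => nt; apply: nl; exists l => t.
  apply: contrapT => nt'; apply: nt; exists t => t' t'l.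
  by rewrite leNgt; apply/negP => h; apply: nt'; exists t'.
(* Otherwise there are values of u at mutual distance at least e, and no
   subsequence of translates converges at 0. *)
pose L := fix L n := if n is m.+1 then f (L m) :: L m else [::] : seq R.
have sL m n : (m < n)%N -> f (L m) \in L n.
  elim: n => // n IH; rewrite ltnS leq_eqVlt => /orP[/eqP ->|/IH h] /=.
    exact: mem_head.
  by rewrite inE h orbT.
have [g [ig [psi /(_ 0)[+ _]]]] := uAA (fun n => f (L n)).
move=> /cvg_nrmP/(_ _ (divr_gt0 e0 (ltr0Sn R 1)))[N _ hN].
have h1 := hN N (leqnn N); have h2 := hN N.+1 (leqnSn N); rewrite /= !add0r in h1 h2.
have := fP (L (g N.+1)) _ (sL _ _ (ig _ _ (ltnSn N))).
apply/negP; rewrite -ltNge (le_lt_trans (nrm_dist _ (psi 0) _))//.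
by rewrite (splitr e) ltrD// nrmB.
Qed.

(** An ultrafilter on the totally bounded range is Cauchy. *)
Lemma AA_compact_range u : AA u -> compact (closure (range u)).
Proof.
move=> uAA; rewrite compact_ultra => F UF Fu.
have Fcau : cauchy F.
  apply/cauchy_ballP => -[a b]; rewrite ltcE/= => /andP[/eqP -> {b} a0].
  have a40 : 0 < a / 4 by rewrite divr_gt0.
  have [l hl] := AA_totally_bounded uAA a40.
  have FU : F [set x | exists2 t, t \in l & nrm (x - u t) < a / 2].
    apply: filterS Fu => x /(_ [set y | nrm (y - x) < a / 4]) h.
    have [|_ [[t _ <-] /= tx]] := h.
      by apply/nbhs_ballP; exists (a / 4)%:C => /=;
        [rewrite ltcR|move=> y; rewrite -ball_normE/= normE_nrm ltcR nrmB].
    have [t' t'l ht'] := hl t; exists t' => //.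
    rewrite (le_lt_trans (nrm_dist _ (u t) _))// nrmB.
    by move: tx ht'; lra.
  have [t Ft] : exists t, F [set x | nrm (x - u t) < a / 2].
    elim: l FU {hl} => [|t l IH] FU.
      by case: (@filter_not_empty _ F _); apply: filterS FU => x [].
    have [Ft|nFt] := in_ultra_setVsetC [set x | nrm (x - u t) < a / 2] UF.
      by exists t.
    apply: IH; apply: filterS2 FU nFt => x [t' + ht'] nt.
    rewrite inE => /orP[/eqP t't|t'l]; last by exists t'.
    by case: nt; rewrite /= -t't.
  exists ([set x | nrm (x - u t) < a / 2], [set x | nrm (x - u t) < a / 2]) => //=.
  move=> [x y] [/= xt yt]; rewrite -ball_normE/= normE_nrm ltcR.
  rewrite (le_lt_trans (nrm_dist _ (u t) _))// (splitr a) ltrD//.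
  by rewrite nrmB.
have Fl : F --> lim F by apply: cauchy_cvg.
exists (lim F); split=> //.
apply: closed_closure => B /Fl FB.
by have [x] := filter_ex (filterI Fu FB); exists x.
Qed.

Lemma cvg_closure_range u (x : nat -> R) l :
  u (x n) @[n --> \oo] --> l -> closure (range u) l.
Proof.
move=> ul B /ul[N _ /(_ N (leqnn N)) /= uB].
by exists (u (x N)); split => //; exists (x N).
Qed.

End AlmostAutomorphicRange.

Section Superposition.
Context {R : realType} {X : completeNormedModType R[i]}.
Local Notation BC := (@bounded_continuous R X R).
Implicit Types (u v : R -> X) (f : R * (X * X) -> X).

Lemma continuous_superposition f u v : continuous f -> continuous u -> continuous v ->
  continuous (fun t => f (t, (u t, v t))).
Proof.
move=> cf cu cv t.
have cuv : (u x, v x) @[x --> t] --> (u t, v t).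
  by apply: (cvg_pair (cu t) (cv t)).
have ctuv : (x, (u x, v x)) @[x --> t] --> (t, (u t, v t)).
  by apply: (cvg_pair cvg_id cuv).
exact: cvg_comp ctuv (cf _).
Qed.

Lemma superposition_bc f u v : bounded_continuous f -> BC u -> BC v ->
  BC (fun t => f (t, (u t, v t))).
Proof.
move=> [cf [c fc]] [cu _] [cv _]; split; first exact: continuous_superposition.
by exists c.
Qed.

Lemma bounded_set_nrm (c : R) :
  bounded_set [set p : X * X | nrm p.1 <= c /\ nrm p.2 <= c].
Proof.
exists c%:C; split; first by rewrite complex_real.
move=> [a b]; rewrite ltcE/= => /andP[/eqP -> ca] p [p1 p2] /=.
rewrite prod_normE/= !normE_nrm /Order.max/=.
by case: ifP => _; rewrite lecR (le_trans _ (ltW ca)).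
Qed.

Lemma superposition_C0 f u v : C0_param f -> BC u -> BC v ->
  nrm (f (t, (u t, v t))) @[t --> +oo] --> (0 : R).
Proof.
move=> [_ f0] [_ [c uc]] [_ [c' vc]]; apply/cvgr0Pnorm_lt => e e0.
have := f0 _ (@bounded_set_nrm (Num.max c c')) e e0; apply: filterS => t h.
rewrite ger0_norm ?nrm_ge0//; apply: h.
by rewrite /= !le_max uc vc orbT.
Qed.

(** The almost automorphic part of a sum does not exceed the bound of the sum,
    because the values of the vanishing part disappear along translations to
    infinity. *)
Lemma AA_C0_bound (h h2 : R -> X) c : AA h -> nrm (h2 t) @[t --> +oo] --> (0 : R) ->
  (forall t, nrm (h t + h2 t) <= c) -> forall t, nrm (h t) <= c.
Proof.
move=> [_ hAA] h20 hc t.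
(* psi is the limit of the translates of the sum, since those of h2 vanish; and
   h is in turn a limit of translates of psi. *)
have [e [ie [psi he]]] := hAA (fun n => n%:R).
have psic r : nrm (psi r) <= c.
  have [hpsi _] := he r; apply/ler_addgt0Pr => d d0.
  apply: nrm_lim_le hpsi; move/cvgr0Pnorm_lt : h20 => /(_ _ d0)[A [_ hA]].
  exists (Num.truncn `|A - r|).+1 => // n /= nA.
  have /hA : A < r + (e n)%:R.
    have /(_ n) := homo_ltn_le ie; rewrite -(ler_nat R) => en.
    have := truncnS_gt `|A - r|; have := ler_norm (A - r).
    move: nA; rewrite -(ler_nat R); lra.
  rewrite ger0_norm ?nrm_ge0// => h2d.
  rewrite -[h _](addrK (h2 (r + (e n)%:R))) (le_trans (nrmD _ _))// nrmN.
  by rewrite lerD// ltW.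
have [_ hpsi] := he t.
by apply: nrm_lim_le hpsi; exact: nearW.
Qed.

Lemma AA_param_sub f p q : AA_param f -> AA (fun t => f (t, p) - f (t, q)).
Proof.
move=> [[cf [c fc]] fAA]; split.
  split.
    have cfp y t : f (x, y) @[x --> t] --> f (t, y).
      have cty : (x, y) @[x --> t] --> (t, y).
        by apply: (cvg_pair cvg_id (cvg_cst y)).
      exact: cvg_comp cty (cf _).
    by move=> t; apply: cvgB; exact: cfp.
  by exists (c + c) => t; rewrite (le_trans (nrmD _ _))// nrmN lerD.
move=> s; have [|e [ie [psi he]]] := fAA ([set p] `|` [set q]) s.
  by apply: compactU; exact: compact_set1.
exists e; split => //; exists (fun t => psi t p - psi t q) => t.
have [hp1 hp2] := he t p (or_introl erefl).
have [hq1 hq2] := he t q (or_intror erefl).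
by split; apply: cvgB.
Qed.

Lemma AA_part_lipschitz f f1 f2 L : AA_param f1 -> C0_param f2 ->
  (forall p, f p = f1 p + f2 p) ->
  (forall t (u v phi psi : X), nrm (f (t, (u, phi)) - f (t, (v, psi)))
       <= L * (nrm (u - v) + nrm (phi - psi))) ->
  forall t (u v phi psi : X), nrm (f1 (t, (u, phi)) - f1 (t, (v, psi)))
       <= L * (nrm (u - v) + nrm (phi - psi)).
Proof.
move=> f1AA f2C0 fE flip t u v phi psi.
have BCc (x : X) : BC (fun=> x).
  by split; [move=> ?; exact: cvg_cst|exists (nrm x)].
apply: (@AA_C0_bound (fun t => f1 (t, (u, phi)) - f1 (t, (v, psi)))
   (fun t => f2 (t, (u, phi)) - f2 (t, (v, psi)))).
- exact: AA_param_sub.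
- have h1 := superposition_C0 f2C0 (BCc u) (BCc phi).
  have h2 := superposition_C0 f2C0 (BCc v) (BCc psi).
  apply: (@squeeze_cvgr _ _ _ _ (cst 0)
    (fun t => nrm (f2 (t, (u, phi))) + nrm (f2 (t, (v, psi))))).
  + by apply: nearW => r; rewrite nrm_ge0 (le_trans (nrmD _ _))// nrmN.
  + exact: cvg_cst.
  + by rewrite -[X in _ --> X]addr0; apply: cvgD.
- by move=> r; rewrite addrACA -opprD -!fE.
Qed.

(** Composition with a Lipschitz function: the uniformity on compact sets of
    almost automorphy in the parameter is used on the closure of the range. *)
Lemma superposition_AA f L u v : 0 <= L -> AA_param f ->
  (forall t (u v phi psi : X), nrm (f (t, (u, phi)) - f (t, (v, psi)))
       <= L * (nrm (u - v) + nrm (phi - psi))) ->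
  AA u -> AA v -> AA (fun t => f (t, (u t, v t))).
Proof.
move=> L0 [bf fAA] flip uAA vAA; split.
  by apply: superposition_bc => //; [case: uAA|case: vAA].
have cQ : compact (closure (range u) `*` closure (range v)).
  by apply: compact_setX; exact: AA_compact_range.
have [[_ uAA'] [_ vAA']] := (uAA, vAA).
have sub (x : nat -> X) (l : X) (e : nat -> nat) : {homo e : m n / (m < n)%N} ->
    x n @[n --> \oo] --> l -> x (e n) @[n --> \oo] --> l.
  move=> ie xl; apply: (@cvg_eventually_extracted _ _ x l id e _ xl).
  by exists 0%N => n _; exists (e n) => //; exact: homo_ltn_le.
move=> s; have [e1 [ie1 [pu hu]]] := uAA' s.
have [e2 [ie2 [pv hv]]] := vAA' (s \o e1).
have [e3 [ie3 [pf hf]]] := fAA _ (s \o e1 \o e2) cQ.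
pose e := e1 \o e2 \o e3.
have ie23 : {homo e2 \o e3 : m n / (m < n)%N} by move=> m n mn; apply/ie2/ie3.
exists e; split; first by move=> m n mn; apply/ie1/ie23.
have hu1 t : u (t + s (e n)) @[n --> \oo] --> pu t.
  exact: (sub (fun m => u (t + s (e1 m))) _ _ ie23 (hu t).1).
have hu2 t : pu (t - s (e n)) @[n --> \oo] --> u t.
  exact: (sub (fun m => pu (t - s (e1 m))) _ _ ie23 (hu t).2).
have hv1 t : v (t + s (e n)) @[n --> \oo] --> pv t.
  exact: (sub (fun m => v (t + s (e1 (e2 m)))) _ _ ie3 (hv t).1).
have hv2 t : pv (t - s (e n)) @[n --> \oo] --> v t.
  exact: (sub (fun m => pv (t - s (e1 (e2 m)))) _ _ ie3 (hv t).2).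
have Q1 t : (closure (range u) `*` closure (range v)) (pu t, pv t).
  by split; [exact: cvg_closure_range (hu1 t)|exact: cvg_closure_range (hv1 t)].
have Q2 t : (closure (range u) `*` closure (range v)) (u t, v t).
  by split; apply: subset_closure; exists t.
have pflip t p q : (closure (range u) `*` closure (range v)) p ->
    (closure (range u) `*` closure (range v)) q ->
    nrm (pf t p - pf t q) <= L * (nrm (p.1 - q.1) + nrm (p.2 - q.2)).
  move=> Qp Qq; apply: (@nrm_lim_le _ _ _ \oo _
      (fun n => f (t + s (e n), p) - f (t + s (e n), q))).
    by apply: nearW => n; case: p q {Qp Qq} => [p1 p2] [q1 q2]; exact: flip.
  by apply: cvgB; [exact: (hf t p Qp).1|exact: (hf t q Qq).1].
have lim0 (x y : nat -> X) (a b : X) : x n @[n --> \oo] --> a -> y n @[n --> \oo] --> b ->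
    L * (nrm (x n - a) + nrm (y n - b)) @[n --> \oo] --> (0 : R).
  move=> /cvg_nrm0P xa /cvg_nrm0P yb.
  have -> : (0 : R) = L * (0 + 0) by rewrite addr0 mulr0.
  by apply: cvgM; [exact: cvg_cst|exact: cvgD].
exists (fun t => pf t (pu t, pv t)) => t; split.
- rewrite -[X in _ --> X]add0r.
  rewrite (_ : (fun n => f _) = fun n =>
    (f (t + s (e n), (u (t + s (e n)), v (t + s (e n)))) - f (t + s (e n), (pu t, pv t)))
    + f (t + s (e n), (pu t, pv t))); last by apply/funext => n; rewrite subrK.
  apply: cvgD; last exact: (hf t _ (Q1 t)).1.
  apply: cvg_nrm_le (lim0 _ _ _ _ (hu1 t) (hv1 t)).
  by apply: nearW => n; rewrite subr0; exact: flip.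
- rewrite -[X in _ --> X]add0r.
  rewrite (_ : (fun n => pf _ _) = fun n =>
    (pf (t - s (e n)) (pu (t - s (e n)), pv (t - s (e n))) - pf (t - s (e n)) (u t, v t))
    + pf (t - s (e n)) (u t, v t)); last by apply/funext => n; rewrite subrK.
  apply: cvgD; last exact: (hf t _ (Q2 t)).2.
  apply: cvg_nrm_le (lim0 _ _ _ _ (hu2 t) (hv2 t)).
  by apply: nearW => n; rewrite subr0; exact: pflip.
Qed.

End Superposition.

(** * Partial fractions of the cosecant *)

Section CosecantExpansion.
Context {R : realType}.
Implicit Types (a c x y z : R) (n N : nat).

Lemma is_derive_ext (f g : R -> R) x d d' : is_derive x 1 f d -> f =1 g -> d = d' ->
  is_derive x 1 g d'.
Proof. by move=> fd /funext <- <-. Qed.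

Lemma is_derive_lin c x : is_derive x 1 (fun y => c * y) c.
Proof.
apply: (is_derive_ext (is_deriveZ c (is_derive_id x (1 : R)))) => //.
by rewrite /GRing.scale/= mulr1.
Qed.

Lemma is_derive_sin_lin c x : is_derive x 1 (fun y => sin (c * y)) (c * cos (c * x)).
Proof.
apply: (is_derive_ext (is_derive1_comp (is_derive_sin (c * x)) (is_derive_lin c x))) => //.
exact: mulrC.
Qed.

Lemma is_derive_cos_lin c x : is_derive x 1 (fun y => cos (c * y)) (- (c * sin (c * x))).
Proof.
apply: (is_derive_ext (is_derive1_comp (is_derive_cos (c * x)) (is_derive_lin c x))) => //.
by rewrite mulNr mulrC.
Qed.

Lemma is_derive_bigsum (N : nat) (T T' : nat -> R -> R) x :
  (forall n, is_derive x 1 (T n) (T' n x)) ->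
  is_derive x 1 (fun y => \sum_(n < N) T n y) (\sum_(n < N) T' n x).
Proof.
move=> hT; elim: N => [|N IH].
  rewrite big_ord0 (_ : (fun y => _) = cst 0); first exact: is_derive_cst.
  by apply/funext => y; rewrite big_ord0.
rewrite big_ord_recr (_ : (fun y => _) = (fun y => \sum_(n < N) T n y) + T N).
  exact: is_deriveD.
by apply/funext => y; rewrite big_ord_recr.
Qed.

Lemma norm_sin_le y : `|sin y| <= `|y|.
Proof.
wlog y0 : y / 0 <= y.
  move=> h; case: (leP 0 y) => [/h//|/ltW y0].
  by have := h (- y); rewrite sinN !normrN oppr_ge0; exact.
have [c _ ->] : exists2 c, c \in `[0, y] & sin y = cos c * y.
  have [c c0y] := @MVT_segment R (@sin R) (@cos R) 0 y y0
    (fun x _ => is_derive_sin x) (continuous_subspaceT (@continuous_sin R)).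
  by rewrite sin0 !subr0 => ->; exists c.
by rewrite normrM ler_piMl// cos_max.
Qed.

Lemma cos_half_angle y : cos y = 2 * cos (y / 2) ^+ 2 - 1.
Proof. by rewrite {1}(splitr y) -mulr2n cos_mulr2n -[X in X - _ = _]mulr_natl. Qed.

Lemma sin_half_angle y : sin y = 2 * (cos (y / 2) * sin (y / 2)).
Proof. by rewrite {1}(splitr y) -mulr2n sin_mulr2n -[LHS]mulr_natl. Qed.

Lemma one_sub_cos_le y : `|cos y - 1| <= y ^+ 2 / 2.
Proof.
have -> : cos y - 1 = - (2 * sin (y / 2) ^+ 2).
  by rewrite cos_half_angle cos2sin2; ring.
rewrite normrN ger0_norm; last by rewrite mulr_ge0// sqr_ge0.
have -> : y ^+ 2 / 2 = 2 * (y / 2) ^+ 2 by field.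
rewrite ler_pM2l// -real_normK ?num_real// -(real_normK (num_real (y / 2))).
by rewrite lerXn2r ?nnegrE// norm_sin_le.
Qed.

Lemma half_le_sin y : 0 <= y <= pi / 2 -> y / 2 <= sin y.
Proof.
move=> /andP[y0 ypi]; have pi0 := @pi_gt0 R.
have hz : 0 <= y / 2 <= pi by lra.
have [c /andP[c0 cy] sE] : exists2 c, 0 <= c <= y / 2 & sin (y / 2) = cos c * (y / 2).
  have [|c + ] := @MVT_segment R (@sin R) (@cos R) 0 (y / 2) _
    (fun x _ => is_derive_sin x) (continuous_subspaceT (@continuous_sin R)); first lra.
  by rewrite sin0 !subr0 in_itv/= => ? ->; exists c.
have cosc : cos (y / 2) <= cos c.
  move: cy; rewrite le_eqVlt => /orP[/eqP ->//|cy].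
  by apply: ltW; rewrite ltr_cos ?in_itv//=; lra.
have cz0 : 0 <= cos (y / 2) by apply: cos_ge0_pihalf; lra.
have cy0 : 0 <= cos y by apply: cos_ge0_pihalf; lra.
rewrite sin_half_angle; have hcos := cos_half_angle y.
have h1 : cos (y / 2) * (cos (y / 2) * (y / 2)) <= cos (y / 2) * sin (y / 2).
  by rewrite sE ler_wpM2l// ler_wpM2r//; lra.
suff : y / 2 <= 2 * (cos (y / 2) * (cos (y / 2) * (y / 2))) by lra.
have -> : 2 * (cos (y / 2) * (cos (y / 2) * (y / 2))) = (1 + cos y) * (y / 2).
  by rewrite hcos; ring.
by rewrite mulrDl mul1r lerDl mulr_ge0//; lra.
Qed.

(** The Dirichlet kernel. *)
Definition dirichlet N x : R := 1 + 2 * \sum_(n < N) cos (n.+1%:R * x).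

Lemma dirichlet_sin N x :
  dirichlet N x * sin (2^-1 * x) = sin ((N%:R + 2^-1) * x).
Proof.
rewrite /dirichlet; elim: N => [|N IH].
  by rewrite big_ord0 mulr0 addr0 mul1r add0r.
rewrite big_ord_recr/= mulrDr addrA mulrDl IH.
have -> : (N%:R + 2^-1) * x = N.+1%:R * x - 2^-1 * x by rewrite -natr1; field.
have -> : (N.+1%:R + 2^-1) * x = N.+1%:R * x + 2^-1 * x by rewrite mulrDl.
by rewrite sinB sinD; ring.
Qed.

Variable a : R.
Hypothesis a01 : 0 < a < 1.

(** Primitive of [2 (cos (a x) - 1) cos ((n+1) x)]. *)
Definition fourier_term n x : R :=
  sin ((n.+1%:R + a) * x) / (n.+1%:R + a)
  + sin ((n.+1%:R - a) * x) / (n.+1%:R - a)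
  - 2 * (sin (n.+1%:R * x) / n.+1%:R).

(** Primitive of [cos (a x) - 1] times the Dirichlet kernel. *)
Definition fourier_sum N x : R :=
  sin (a * x) / a - x + \sum_(n < N) fourier_term n x.

Let a0 : 0 < a. Proof. by case/andP: a01. Qed.
Let na1 n : 0 < n.+1%:R + a. Proof. by rewrite ltr_wpDl. Qed.
Let na2 n : 0 < n.+1%:R - a.
Proof.
by have /andP[_ a1] := a01; rewrite subr_gt0 (lt_le_trans a1)// ler1n.
Qed.

Lemma is_derive_sin_div c x : c != 0 ->
  is_derive x 1 (fun y => sin (c * y) / c) (cos (c * x)).
Proof.
move=> c0; apply: (@is_derive_ext (c^-1 \*: (fun y => sin (c * y)))
  _ _ (c^-1 *: (c * cos (c * x)))).
- by apply: is_deriveZ; exact: is_derive_sin_lin.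
- by move=> y /=; rewrite /GRing.scale/= mulrC.
- by rewrite /GRing.scale/= mulrA mulVf// mul1r.
Qed.

Lemma is_derive_fourier_sum N x :
  is_derive x 1 (fourier_sum N) ((cos (a * x) - 1) * dirichlet N x).
Proof.
have dT n : is_derive x 1 (fourier_term n)
    (cos ((n.+1%:R + a) * x) + cos ((n.+1%:R - a) * x) - 2 * cos (n.+1%:R * x)).
  have h1 := is_derive_sin_div x (lt0r_neq0 (na1 n)).
  have h2 := is_derive_sin_div x (lt0r_neq0 (na2 n)).
  have h3 := is_derive_sin_div x (lt0r_neq0 (ltr0Sn R n)).
  exact: is_deriveB (is_deriveD h1 h2) (is_deriveZ 2 h3).
have dS := is_derive_bigsum N (T' := fun n x => cos ((n.+1%:R + a) * x) +
    cos ((n.+1%:R - a) * x) - 2 * cos (n.+1%:R * x)) dT.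
have d0 := is_deriveB (is_derive_sin_div x (lt0r_neq0 a0)) (is_derive_id x (1 : R)).
apply: is_derive_eq (is_deriveD d0 dS) _.
rewrite /dirichlet mulrDr mulr1; congr (_ + _).
rewrite mulrCA !mulr_sumr; apply: eq_bigr => n _.
by rewrite mulrDl mulrBl cosD cosB; ring.
Qed.

(** The quotient by which [sin ((N + 1/2) x)] is multiplied in the derivative of
    [fourier_sum N]; its value at 0, where the division is by 0, plays no role. *)
Definition fourier_quot x : R := (cos (a * x) - 1) / sin (2^-1 * x).

(** Derivative of [fourier_quot], bounded on the half-open interval. *)
Definition fourier_quot' x : R :=
  (- (a * sin (a * x)) * sin (2^-1 * x)
   - (cos (a * x) - 1) * (2^-1 * cos (2^-1 * x))) / sin (2^-1 * x) ^+ 2.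

Lemma sin_half_gt0 x : 0 < x <= pi -> x / 4 <= sin (2^-1 * x).
Proof.
move=> /andP[x0 xpi]; have := @half_le_sin (2^-1 * x).
have -> : 0 <= 2^-1 * x <= pi / 2 by lra.
by move=> /(_ isT); apply: le_trans; lra.
Qed.

Lemma is_derive_fourier_quot x : 0 < x <= pi ->
  is_derive x 1 fourier_quot (fourier_quot' x).
Proof.
move=> xpi; have x0 : 0 < x by case/andP: xpi.
have s0 : sin (2^-1 * x) != 0.
  by rewrite gt_eqF// (lt_le_trans _ (sin_half_gt0 xpi))// divr_gt0.
have dc := is_deriveB (is_derive_cos_lin a x) (is_derive_cst (1 : R) x (1 : R)).
have ds := is_deriveV s0 (is_derive_sin_lin 2^-1 x).
apply: is_derive_eq (is_deriveM dc ds) _.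
rewrite /fourier_quot' /GRing.scale/=.
rewrite [X in X * (- _ * _) + _](_ : _ = cos (a * x) - 1)//.
by field.
Qed.

Lemma sqr_scale_le x : 0 <= x -> (a * x) ^+ 2 <= x ^+ 2.
Proof.
move=> x0; have /andP[_ /ltW a1] := a01.
by rewrite lerXn2r ?nnegrE ?mulr_ge0// ?(ltW a0)// ler_piMl.
Qed.

Lemma fourier_quot'_le x : 0 < x <= pi -> `|fourier_quot' x| <= 16.
Proof.
move=> xpi; have /andP[x0 _] := xpi; have sx := sin_half_gt0 xpi.
have s0 : 0 < sin (2^-1 * x) by rewrite (lt_le_trans _ sx)// divr_gt0.
have /andP[_ a1] := a01.
rewrite /fourier_quot' normrM normfV (ger0_norm (sqr_ge0 _)) ler_pdivrMr ?exprn_gt0//.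
have h1 : `|a * sin (a * x)| <= x.
  rewrite normrM ger0_norm ?(ltW a0)//.
  apply: le_trans (ler_wpM2l (ltW a0) (norm_sin_le _)) _.
  rewrite ger0_norm ?mulr_ge0 ?(ltW a0) ?(ltW x0)//.
  by rewrite mulrA ler_piMl ?(ltW x0)// mulr_ile1// ltW.
have h2 : `|sin (2^-1 * x)| <= x / 2.
  by rewrite (le_trans (norm_sin_le _))// ger0_norm; lra.
have h3 : `|cos (a * x) - 1| <= x ^+ 2 / 2.
  apply: le_trans (one_sub_cos_le _) _.
  by rewrite ler_pM2r ?invr_gt0// sqr_scale_le// ltW.
have h4 : `|2^-1 * cos (2^-1 * x)| <= 2^-1.
  by rewrite normrM ger0_norm// ler_piMr// cos_max.
apply: le_trans (ler_normB _ _) _; rewrite !normrM normrN -[`|2^-1| * _]normrM.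
have p1 := ler_pM (normr_ge0 _) (normr_ge0 _) h1 h2.
have p2 := ler_pM (normr_ge0 _) (normr_ge0 _) h3 h4.
apply: le_trans (lerD p1 p2) _.
have : (x / 4) ^+ 2 <= sin (2^-1 * x) ^+ 2.
  by rewrite lerXn2r ?nnegrE// ?ltW// divr_gt0.
have : 0 <= x ^+ 2 by exact: sqr_ge0.
have -> : (x / 4) ^+ 2 = x ^+ 2 / 16 by field.
have -> : x * (x / 2) = x ^+ 2 / 2 by field.
by move: (x ^+ 2) (sin _ ^+ 2) => A B; lra.
Qed.

Lemma fourier_quot_le x : 0 < x <= pi -> `|fourier_quot x| <= 2 * x.
Proof.
move=> xpi; have /andP[x0 _] := xpi; have sx := sin_half_gt0 xpi.
have s0 : 0 < sin (2^-1 * x) by rewrite (lt_le_trans _ sx)// divr_gt0.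
rewrite /fourier_quot normrM normfV (gtr0_norm s0) ler_pdivrMr//.
apply: le_trans (one_sub_cos_le _) _.
have := sqr_scale_le (ltW x0); have := ler_wpM2l (ltW x0) sx.
have -> : x * (x / 4) = x ^+ 2 / 4 by field.
have -> : 2 * x * sin (2^-1 * x) = 2 * (x * sin (2^-1 * x)) by rewrite mulrA.
by move: (x * sin _) (x ^+ 2) ((a * x) ^+ 2) => A B B'; lra.
Qed.

(** By the mean value theorem for the corrected primitive, whose derivative is
    [fourier_quot' x * cos ((N + 1/2) x) / (N + 1/2)]. *)
Lemma fourier_sum_pi_le N : `|fourier_sum N pi| <= 16 * pi / (N%:R + 2^-1).
Proof.
pose m : R := N%:R + 2^-1; have m0 : 0 < m by rewrite ltr_wpDl.
have pi0 := @pi_gt0 R.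
pose E x := fourier_sum N x + m^-1 * (fourier_quot x * cos (m * x)).
have dE x : 0 < x <= pi -> is_derive x 1 E (m^-1 * (fourier_quot' x * cos (m * x))).
  move=> xpi; have /andP[x0 _] := xpi; have sx := sin_half_gt0 xpi.
  have s0 : sin (2^-1 * x) != 0 by rewrite gt_eqF// (lt_le_trans _ sx)// divr_gt0.
  have dq := is_deriveM (is_derive_fourier_quot xpi) (is_derive_cos_lin m x).
  have dE := is_deriveD (is_derive_fourier_sum N x) (is_deriveZ m^-1 dq).
  apply: (is_derive_ext dE) => //.
  rewrite /GRing.scale/=.
  have -> : (cos (a * x) - 1) * dirichlet N x = fourier_quot x * sin (m * x).
    by rewrite -dirichlet_sin /fourier_quot; field.
  by field; rewrite gt_eqF.
have E_pi : E pi = fourier_sum N pi.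
  rewrite /E; suff -> : cos (m * pi) = 0 by rewrite !mulr0 addr0.
  have -> : m * pi = pi / 2 + pi *+ N.
    by rewrite -(mulr_natl pi N) (mulrC pi) [RHS]addrC -mulrDl.
  by rewrite (alternatingn (@cosDpi R)) cos_pihalf mulr0.
apply/ler_addgt0Pr => e e0.
have fs0 : fourier_sum N x @[x --> 0^'+] --> (0 : R).
  have E0 : fourier_sum N 0 = 0.
    rewrite /fourier_sum mulr0 sin0 mul0r subr0 add0r big1// => n _.
    by rewrite /fourier_term !mulr0 sin0 !mul0r mulr0 subr0 addr0.
  have c0 : {for 0, continuous (fourier_sum N)}.
    apply: differentiable_continuous; apply/derivable1_diffP.
    by have [] := is_derive_fourier_sum N 0.
  by rewrite -[X in _ --> X]E0; exact: cvg_at_right_filter c0.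
(* The formula for the derivative fails at 0: the theorem is applied between a
   small d and pi, and E d is negligible. *)
have e20 : 0 < e / 2 by rewrite divr_gt0.
near (0 : R)^'+ => d.
have d0 : 0 < d by [].
have dpi : d < pi by near: d; exact: nbhs_right_lt.
have fsd : `|fourier_sum N d| < e / 2.
  by near: d; move/cvgr0Pnorm_lt : fs0; apply.
have dm : d < e / 4 * m by near: d; apply: nbhs_right_lt; rewrite mulr_gt0// divr_gt0.
have [c cd Ec] : exists2 c, c \in `]d, pi[ &
    E pi - E d = m^-1 * (fourier_quot' c * cos (m * c)) * (pi - d).
  apply: MVT => //.
    by move=> x; rewrite in_itv/= => /andP[dx xpi]; apply: dE; rewrite (lt_trans d0 dx) ltW.
  apply: derivable_within_continuous => x; rewrite in_itv/= => /andP[dx xpi].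
  have xp : 0 < x <= pi by rewrite (lt_le_trans d0 dx).
  by have [] := dE x xp.
move: cd; rewrite in_itv/= => /andP[dc cpi].
have c0pi : 0 < c <= pi by rewrite (lt_trans d0 dc) ltW.
have hq := fourier_quot'_le c0pi.
have bound1 : `|E pi - E d| <= 16 * pi / m.
  rewrite Ec normrM [`|m^-1 * _|]normrM [`|fourier_quot' c * _|]normrM.
  rewrite [`|m^-1|]gtr0_norm ?invr_gt0// [`|pi - d|]gtr0_norm ?subr_gt0//.
  have : `|fourier_quot' c| * `|cos (m * c)| <= 16.
    by rewrite -[leRHS]mulr1 ler_pM// cos_max.
  move: (_ * `|cos _|) (mulr_ge0 (normr_ge0 (fourier_quot' c)) (normr_ge0 (cos (m * c)))).
  move=> A A0 A16; rewrite -mulrA mulrC ler_pM2r ?invr_gt0//.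
  by apply: ler_pM => //; [rewrite subr_ge0 ltW|rewrite gerBl ltW].
have bound2 : `|m^-1 * (fourier_quot d * cos (m * d))| < e / 2.
  have d0pi : 0 < d <= pi by rewrite d0 ltW.
  have hqd := fourier_quot_le d0pi.
  rewrite normrM [`|fourier_quot d * _|]normrM gtr0_norm ?invr_gt0// mulrC ltr_pdivrMr//.
  have : `|fourier_quot d| * `|cos (m * d)| <= 2 * d.
    by rewrite -[leRHS]mulr1 ler_pM// cos_max.
  by move=> /le_lt_trans; apply; move: dm; lra.
rewrite -E_pi -/m -(subrK (E d) (E pi)) (le_trans (ler_normD _ _))// lerD//.
rewrite /E (le_trans (ler_normD _ _))//.
by have := ltrD fsd bound2; rewrite -splitr; exact: ltW.
Unshelve. all: by end_near. Qed.

(** Symmetric partial sums of the series of [(-1) ^ j / (j + a)] over the integers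
    [j], the terms [j] and [-j] being grouped. *)
Definition csc_sum N : R :=
  a^-1 + \sum_(n < N) (-1) ^+ n.+1 * ((n.+1%:R + a)^-1 - (n.+1%:R - a)^-1).

Lemma fourier_sum_pi N : fourier_sum N pi = sin (a * pi) * csc_sum N - pi.
Proof.
rewrite /fourier_sum /csc_sum (mulrDr (sin (a * pi))) mulr_sumr.
rewrite (eq_bigr (fun n : 'I_N => sin (a * pi) *
  ((-1) ^+ n.+1 * ((n.+1%:R + a)^-1 - (n.+1%:R - a)^-1)))); first by rewrite addrAC.
move=> n _; rewrite /fourier_term.
have E1 : (n.+1%:R + a) * pi = a * pi + pi *+ n.+1.
  by rewrite -(mulr_natl pi n.+1) [RHS]addrC -mulrDl.
have E2 : (n.+1%:R - a) * pi = - (a * pi) + pi *+ n.+1.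
  by rewrite -(mulr_natl pi n.+1) [RHS]addrC -mulrBl.
have E3 : n.+1%:R * pi = 0 + pi *+ n.+1 :> R by rewrite add0r -(mulr_natl pi n.+1).
rewrite E1 E2 E3 !(alternatingn (@sinDpi R)) sin0 sinN mulr0 mul0r mulr0 subr0; ring.
Qed.

(** The expansion of the cosecant in partial fractions. *)
Lemma csc_sum_cvg : csc_sum N @[N --> \oo] --> pi / sin (a * pi).
Proof.
have pi0 := @pi_gt0 R; have /andP[_ a1] := a01.
have s0 : 0 < sin (a * pi).
  by apply: sin_gt0_pi; rewrite mulr_gt0//= gtr_pMl.
have fs0 : fourier_sum N pi @[N --> \oo] --> (0 : R).
  apply/cvgr0Pnorm_lt => e e0.
  exists (Num.truncn (16 * pi / e)).+1 => // N /= hN.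
  apply: le_lt_trans (fourier_sum_pi_le N) _.
  rewrite ltr_pdivrMr; last by rewrite ltr_wpDl.
  rewrite [ltRHS]mulrC -ltr_pdivrMr// (lt_trans (truncnS_gt _))//.
  by apply: (@le_lt_trans _ _ N%:R); [rewrite ler_nat|rewrite ltrDl].
have -> : csc_sum = fun N => (fourier_sum N pi + pi) / sin (a * pi).
  by apply/funext => N; rewrite fourier_sum_pi subrK mulrC mulKf// gt_eqF.
have fspi : fourier_sum N pi + pi @[N --> \oo] --> 0 + pi.
  by apply: cvgD => //; exact: cvg_cst.
by rewrite add0r in fspi; apply: cvgM => //; exact: cvg_cst.
Qed.

End CosecantExpansion.

(** * The integral of the decay bound *)

Section PowerSums.
Context {R : realType}.
Local Notation mu := (@lebesgue_measure R).
Implicit Types (c e : nat -> R) (N : nat) (x t r : R).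

(** Finite sums of real powers. *)
Definition power_sum c e N t : R := \sum_(n < N) c n * t `^ e n.

(** Coefficients and exponents of the termwise primitive. *)
Definition primitive_coef c e n : R := c n / (e n + 1).
Definition primitive_exp e n : R := e n + 1.

Lemma is_derive_power_sum c e N t : 0 < t -> (forall n, e n + 1 != 0) ->
  is_derive t 1 (power_sum (primitive_coef c e) (primitive_exp e) N) (power_sum c e N t).
Proof.
move=> t0 e1; have dT n : is_derive t 1
    (fun y => primitive_coef c e n * y `^ primitive_exp e n) (c n * t `^ e n).
  apply: (is_derive_ext (is_deriveZ (primitive_coef c e n)
    (is_derive1_powR (primitive_exp e n) t0))) => //.
  by rewrite /GRing.scale/= /primitive_coef /primitive_exp addrK mulrA divfK.
exact: (is_derive_bigsum N (T' := fun n x => c n * x `^ e n) dT).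
Qed.

Lemma powR_cvg_right p : 0 <= p -> x `^ p @[x --> (0 : R)^'+] --> (0 `^ p : R).
Proof.
rewrite le_eqVlt => /orP[/eqP <-|p0].
  by rewrite powRr0; under eq_fun do rewrite powRr0; exact: cvg_cst.
by rewrite powR0 ?gt_eqF//; exact: powR_cvg0.
Qed.

Lemma powR_cvgy0 p : p < 0 -> x `^ p @[x --> +oo] --> (0 : R).
Proof.
move=> p0; apply/cvgr0Pnorm_lt => d d0.
exists (Num.max 0 (d `^ p^-1)); split; first exact: num_real.
move=> x; rewrite gt_max => /andP[x0 dx].
rewrite ger0_norm ?powR_ge0// -(opprK p) powRN.
rewrite invf_plt ?posrE ?powR_gt0//.
have -> : d^-1 = (d `^ p^-1) `^ (- p).
  by rewrite -powRrM mulrN mulVf ?lt_eqF// powR_inv1// ltW.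
by rewrite gt0_ltr_powR ?oppr_gt0// nnegrE ?powR_ge0// ltW.
Qed.

Lemma cvg_power_sum (F : set_system R) {FF : Filter F} c e N (l : nat -> R) :
  (forall n, x `^ e n @[x --> F] --> l n) ->
  power_sum c e N x @[x --> F] --> \sum_(n < N) c n * l n.
Proof.
move=> h; rewrite /power_sum; elim: N => [|N IH].
  by under eq_fun do rewrite big_ord0; rewrite big_ord0; exact: cvg_cst.
under eq_fun do rewrite big_ord_recr; rewrite big_ord_recr.
by apply: cvgD => //; apply: cvgM => //; exact: cvg_cst.
Qed.

Lemma continuous_powR p t : 0 < t -> {for t, continuous (@powR R ^~ p)}.
Proof.
move=> t0; apply: differentiable_continuous; apply/derivable1_diffP.
by have [] := is_derive1_powR p t0.
Qed.

Lemma continuous_power_sum c e N t : 0 < t -> {for t, continuous (power_sum c e N)}.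
Proof.
move=> t0; apply: (@cvg_power_sum _ _ _ _ _ (fun n => t `^ e n)) => n.
exact: continuous_powR.
Qed.

Lemma integral_power_sum c e N r : 0 < r -> (forall n, 0 <= e n) ->
  (\int[mu]_(t in `[0%R, r]) (power_sum c e N t)%:E =
    (power_sum (primitive_coef c e) (primitive_exp e) N r)%:E)%E.
Proof.
move=> r0 e0; have e1 n : 0 < e n + 1 by rewrite ltr_wpDl.
pose F := power_sum (primitive_coef c e) (primitive_exp e) N.
have F0 : F 0 = 0.
  by rewrite /F /power_sum big1// => n _; rewrite powR0 ?mulr0// /primitive_exp gt_eqF.
have dF t : 0 < t -> is_derive t 1 F (power_sum c e N t).
  by move=> t0; apply: is_derive_power_sum => // n; rewrite gt_eqF.
rewrite (@continuous_FTC2 _ _ F)//.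
- by rewrite F0 sube0.
- apply/continuous_within_itvP => //; split.
  + by move=> t; rewrite in_itv/= => /andP[t0 _]; exact: continuous_power_sum.
  + by apply: (@cvg_power_sum _ _ _ _ _ (fun n => 0 `^ e n)) => n; exact: powR_cvg_right.
  + by apply: cvg_at_left_filter; exact: continuous_power_sum.
- split.
  + by move=> t; rewrite in_itv/= => /andP[t0 _]; have [] := dF t t0.
  + apply: (@cvg_power_sum _ _ _ _ _ (fun n => 0 `^ primitive_exp e n)) => n.
    by apply: powR_cvg_right; rewrite /primitive_exp ltW.
  + by apply: cvg_at_left_filter; exact: continuous_power_sum.
- move=> t; rewrite in_itv => /andP[t0 _]; rewrite derive1E.
  by have [_ ->] := dF t t0.
Qed.

Lemma integral_power_sumy c e N r : 0 < r -> (forall n, e n < -1) ->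
  (forall t, r <= t -> 0 <= power_sum c e N t) ->
  (\int[mu]_(t in `[r, +oo[) (power_sum c e N t)%:E =
    (- power_sum (primitive_coef c e) (primitive_exp e) N r)%:E)%E.
Proof.
move=> r0 e1 f0; pose F := power_sum (primitive_coef c e) (primitive_exp e) N.
have p0 n : e n + 1 < 0 by rewrite -ltrBrDr add0r.
have dF t : 0 < t -> is_derive t 1 F (power_sum c e N t).
  by move=> t0; apply: is_derive_power_sum => // n; rewrite lt_eqF.
rewrite (@ge0_continuous_FTC2y _ _ F _ 0)//.
- by rewrite sub0e.
- apply/continuous_within_itvcyP; split.
  + move=> t; rewrite in_itv/= andbT => rt; apply: continuous_power_sum.
    exact: lt_trans rt.
  + by apply: cvg_at_right_filter; exact: continuous_power_sum.
- rewrite -[X in _ --> X](_ : \sum_(n < N) primitive_coef c e n * 0 = 0).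
    by apply: (@cvg_power_sum _ _ _ _ _ (fun=> 0)) => n; apply: powR_cvgy0; exact: p0.
  by rewrite big1// => n _; rewrite mulr0.
- by move=> t rt; have [] := dF t (lt_trans r0 rt).
- by apply: cvg_at_right_filter; exact: continuous_power_sum.
- move=> t; rewrite in_itv/= andbT => rt; rewrite derive1E.
  by have [_ ->] := dF t (lt_trans r0 rt).
Qed.

End PowerSums.

Section DecayIntegral.
Context {R : realType}.
Local Notation mu := (@lebesgue_measure R).
Local Notation mset := (set (measurableTypeR R)).
Variables (alpha om : R).
Hypothesis alpha1 : 1 < alpha.
Hypothesis om0 : 0 < om.

(** The integrable bound of the family of operators, up to a factor. *)
Definition decay (t : R) : R := (1 + om * t `^ alpha)^-1.

Let alpha0 : 0 < alpha. Proof. exact: lt_trans alpha1. Qed.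

Lemma decay_den_gt0 t : 0 < 1 + om * t `^ alpha.
Proof. by rewrite ltr_pwDl// mulr_ge0 ?powR_ge0// ltW. Qed.

Lemma decay_ge0 t : 0 <= decay t.
Proof. by rewrite invr_ge0 ltW// decay_den_gt0. Qed.

Lemma decay_nonincreasing r r' : 0 <= r -> r <= r' -> decay r' <= decay r.
Proof.
move=> r0 rr'; rewrite lef_pV2 ?posrE ?decay_den_gt0// lerD2l ler_wpM2l ?(ltW om0)//.
by apply: ge0_ler_powR; rewrite ?nnegrE ?(ltW alpha0)// (le_trans r0).
Qed.

Lemma measurable_decay : measurable_fun (`[0, +oo[ : mset) decay.
Proof.
have -> : decay = (fun y => y `^ (-1)) \o (fun t => 1 + om * t `^ alpha).
  by apply/funext => t /=; rewrite powR_inv1// ltW// decay_den_gt0.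
apply: measurable_funS (_ : measurable_fun setT _) => //.
apply: measurableT_comp => //; apply: measurable_funD => //.
by apply: measurable_funM => //; exact: measurable_powR.
Qed.

(** With an odd number of terms, the partial sums are upper bounds, even where
    the series diverges. *)
Lemma geometric_upper (z : R) m : 0 <= z ->
  (1 + z)^-1 <= \sum_(n < m.*2.+1) (- z) ^+ n.
Proof.
move=> z0; have z1 : 0 < 1 + z by rewrite ltr_pwDl.
rewrite -[leLHS]mul1r ler_pdivrMr// mulrC.
have := subrX1 (- z) m.*2.+1; move: (\sum_(n < _) _) => S hS.
suff : (1 + z) * S = 1 + z ^+ m.*2.+1.
  by move=> ->; rewrite lerDl exprn_ge0.
have -> : (1 + z) * S = - ((- z - 1) * S) by ring.
by rewrite -hS exprNn -signr_odd /= odd_double expr1; ring.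
Qed.

(** The point where [om * t ^ alpha = 1]. *)
Let rho : R := om `^ (- alpha^-1).

Let rho0 : 0 < rho. Proof. exact: powR_gt0. Qed.

Let om_rho : om * rho `^ alpha = 1.
Proof.
by rewrite /rho -powRrM mulNr mulVf ?gt_eqF// powR_inv1 ?ltW// divff// gt_eqF.
Qed.

Let om_rho_n n : om ^+ n * rho `^ (alpha * n%:R) = 1.
Proof. by rewrite powRrM powR_mulrn ?powR_ge0// -exprMn om_rho expr1n. Qed.

(** Coefficients and exponents of the expansions below and above [rho]. *)
Let c0 n : R := (-1) ^+ n * om ^+ n.
Let e0 n : R := alpha * n%:R.
Let c1 n : R := (-1) ^+ n * om ^- n.+1.
Let e1 n : R := - (alpha * n.+1%:R).

Lemma decay_le_near t m : 0 <= t -> decay t <= power_sum c0 e0 m.*2.+1 t.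
Proof.
move=> t0; have z0 : 0 <= om * t `^ alpha by rewrite mulr_ge0 ?powR_ge0// ltW.
apply: le_trans (geometric_upper m z0) _; rewrite /power_sum le_eqVlt; apply/orP; left.
apply/eqP/eq_bigr => n _; rewrite /c0 /e0 powRrM powR_mulrn ?powR_ge0//.
by rewrite [LHS]exprNn exprMn mulrA.
Qed.

Lemma decay_le_far t m : 0 < t -> decay t <= power_sum c1 e1 m.*2.+1 t.
Proof.
move=> t0; have z0 : 0 < om * t `^ alpha by rewrite mulr_gt0 ?powR_gt0.
have -> : decay t = (om * t `^ alpha)^-1 * (1 + (om * t `^ alpha)^-1)^-1.
  rewrite /decay; move: (om * _) z0 => z z0; field.
  by rewrite !gt_eqF ?ltr_wpDr ?(ltW z0).
have iz0 : 0 <= (om * t `^ alpha)^-1 by rewrite invr_ge0 ltW.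
apply: le_trans (ler_wpM2l iz0 (geometric_upper m iz0)) _.
rewrite mulr_sumr /power_sum le_eqVlt; apply/orP; left.
apply/eqP/eq_bigr => n _; rewrite /c1 /e1 powRN powRrM powR_mulrn ?powR_ge0//.
rewrite [X in _ * X = _]exprNn mulrCA -exprS -mulrA; congr (_ * _).
by rewrite exprVn exprMn invfM.
Qed.

Lemma power_sum_near N : power_sum (primitive_coef c0 e0) (primitive_exp e0) N rho =
  rho / alpha * \sum_(n < N) (-1) ^+ n / (n%:R + alpha^-1).
Proof.
rewrite mulr_sumr; apply: eq_bigr => n _; rewrite /primitive_coef /primitive_exp /c0 /e0.
have a1 : 0 < alpha * n%:R + 1 by rewrite ltr_wpDl// mulr_ge0// ltW.
rewrite powRD ?(gt_eqF a1)// powRr1 ?(ltW rho0)//.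
have := om_rho_n n; move: (_ `^ (_ * _)) (om ^+ n) => A B AB.
have -> : (-1) ^+ n * B / (alpha * n%:R + 1) * (A * rho) =
  (-1) ^+ n * rho * (B * A) / (alpha * n%:R + 1) by ring.
rewrite AB; field.
by rewrite (mulrC n%:R) !gt_eqF.
Qed.

Lemma power_sum_far N : - power_sum (primitive_coef c1 e1) (primitive_exp e1) N rho =
  rho / alpha * \sum_(n < N) (-1) ^+ n / (n.+1%:R - alpha^-1).
Proof.
rewrite mulr_sumr -sumrN; apply: eq_bigr => n _.
rewrite /primitive_coef /primitive_exp /c1 /e1.
have a1 : 0 < alpha * n.+1%:R - 1.
  by rewrite subr_gt0 (lt_le_trans alpha1)// ler_peMr ?ler1n// ltW.
rewrite powRD; last by rewrite (gt_eqF rho0) implybT.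
rewrite powRr1 ?(ltW rho0)// powRN.
have := om_rho_n n.+1; rewrite -exprVn => /(congr1 GRing.inv).
rewrite invfM invr1 -exprVn; move: (_ `^ (_ * _)) (om^-1 ^+ n.+1) => A B AB.
have -> : (-1) ^+ n * B / (- (alpha * n.+1%:R) + 1) * (A^-1 * rho) =
  (-1) ^+ n * rho * (B * A^-1) / (- (alpha * n.+1%:R) + 1) by ring.
rewrite AB; move: a1; move: (n.+1%:R) => q a1.
have n1 : q * alpha - 1 != 0 by rewrite mulrC gt_eqF.
have n2 : - (alpha * q) + 1 != 0 by rewrite -oppr_eq0 opprD opprK gt_eqF.
by field; rewrite n1 n2 gt_eqF.
Qed.

Let a01 : 0 < alpha^-1 < 1.
Proof. by rewrite invr_gt0 alpha0 invf_lt1. Qed.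

Lemma alternating_csc_sum N :
  \sum_(n < N) (-1) ^+ n / (n%:R + alpha^-1) +
  \sum_(n < N) (-1) ^+ n / (n.+1%:R - alpha^-1) =
  csc_sum alpha^-1 N - (-1) ^+ N / (N%:R + alpha^-1) :> R.
Proof.
rewrite /csc_sum; elim: N => [|N IH].
  by rewrite !big_ord0 !addr0 add0r invrK expr0 mul1r subrr.
rewrite !big_ord_recr/= addrACA IH exprS; ring.
Qed.

Lemma integral_decay_le_partial N m : m = N.*2.+1 ->
  (\int[mu]_(t in `[0%R, +oo[) (decay t)%:E <=
   (rho / alpha * (csc_sum alpha^-1 m + (m%:R + alpha^-1)^-1))%:E)%E.
Proof.
move=> mE.
have -> : `[0, +oo[%classic = `[0, rho] `|` `]rho, +oo[%classic :> set R.
  by rewrite -itv_bndbnd_setU// bnd_simp ltW.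
have mD : measurable_fun (`[0, +oo[ : mset) (fun t => (decay t)%:E).
  by apply/measurable_EFinP; exact: measurable_decay.
rewrite ge0_integral_setU//; last 3 first.
- by apply: measurable_funS mD => // t [] /=; rewrite !in_itv/= !andbT;
    [case/andP|move=> /ltW; apply: le_trans; exact: ltW].
- by move=> t _; rewrite lee_fin decay_ge0.
- apply/disj_setPS => t [] /=; rewrite !in_itv/= andbT.
  by move=> /andP[_ /le_lt_trans h] /h; rewrite ltxx.
have -> : rho / alpha * (csc_sum alpha^-1 m + (m%:R + alpha^-1)^-1) =
  power_sum (primitive_coef c0 e0) (primitive_exp e0) m rho
  - power_sum (primitive_coef c1 e1) (primitive_exp e1) m rho.
  rewrite power_sum_near power_sum_far -mulrDr alternating_csc_sum.
  by rewrite -signr_odd mE /= odd_double expr1 mulN1r opprK.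
rewrite EFinD; apply: leeD.
- rewrite -integral_power_sum//; last first.
    by move=> n; rewrite /e0 mulr_ge0// ltW.
  apply: ge0_integral_le => t /=; rewrite in_itv/= => /andP[t0 _].
    by rewrite lee_fin decay_ge0.
  by rewrite lee_fin mE decay_le_near.
- have e1N n : e1 n < -1.
    by rewrite /e1 ltrN2 (lt_le_trans alpha1)// ler_peMr ?ler1n// ltW.
  rewrite -integral_power_sumy//; last first.
    move=> t rt; apply: le_trans (decay_ge0 t) _; rewrite mE; apply: decay_le_far.
    exact: lt_le_trans rt.
  apply: (@le_trans _ _ (\int[mu]_(t in `[rho, +oo[) (decay t)%:E)%E).
    apply: ge0_subset_integral => //.
    + apply: measurable_funS mD => // t /=; rewrite !in_itv/= !andbT.
      by apply: le_trans; exact: ltW.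
    + by move=> t _; rewrite lee_fin decay_ge0.
    + by move=> t /=; rewrite !in_itv/= !andbT; exact: ltW.
  apply: ge0_integral_le => t /=; rewrite in_itv/= andbT => rt.
    by rewrite lee_fin decay_ge0.
  by rewrite lee_fin mE decay_le_far// (lt_le_trans rho0).
Qed.

Lemma integral_decay_le :
  (\int[mu]_(t in `[0%R, +oo[) (decay t)%:E <=
   (om `^ (- (1 / alpha)) * pi / (alpha * sin (pi / alpha)))%:E)%E.
Proof.
have h : rho / alpha * (csc_sum alpha^-1 N.*2.+1 + (N.*2.+1%:R + alpha^-1)^-1)
    @[N --> \oo] --> rho / alpha * (pi / sin (alpha^-1 * pi) + 0).
  apply: cvgM; first exact: cvg_cst.
  have oddoo : N.*2.+1 @[N --> \oo] --> \oo.
    apply/cvgnyPge => M; exists M => // n /= Mn.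
    by rewrite (leq_trans Mn)// ltnW// ltnS -addnn leq_addr.
  apply: cvgD; first exact: (cvg_comp _ _ oddoo (csc_sum_cvg a01)).
  apply: (@squeeze_cvgr _ _ _ _ (cst 0) (fun N => N.+1%:R^-1)).
  + apply: nearW => n; rewrite invr_ge0 addr_ge0 ?invr_ge0 ?(ltW alpha0)//=.
    rewrite lef_pV2 ?posrE ?ltr_wpDl ?invr_gt0//.
    rewrite -[leLHS]addr0 lerD ?invr_ge0 ?(ltW alpha0)// ler_nat ltnS -addnn.
    exact: leq_addr.
  + exact: cvg_cst.
  + exact: cvg_harmonic.
have -> : om `^ (- (1 / alpha)) * pi / (alpha * sin (pi / alpha)) =
    rho / alpha * (pi / sin (alpha^-1 * pi) + 0).
  by rewrite /rho div1r addr0 (mulrC alpha^-1) invfM; ring.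
have hE : (rho / alpha * (csc_sum alpha^-1 N.*2.+1 + (N.*2.+1%:R + alpha^-1)^-1))%:E
    @[N --> \oo] --> (rho / alpha * (pi / sin (alpha^-1 * pi) + 0))%:E.
  by apply: cvg_EFin h; exact: nearW.
apply: lee_cvg_to (cvg_cst (\int[mu]_(t in `[0%R, +oo[) (decay t)%:E)%E) hE _.
by apply: nearW => N; exact: integral_decay_le_partial.
Qed.

End DecayIntegral.

(** * The fixed point problem *)

Section FixedPointProblem.
Context {R : realType} {X : completeNormedModType R[i]}.
Local Notation mset := (set (measurableTypeR R)).
Local Notation BC := (@bounded_continuous R X R).
Variables (k : R -> R[i]) (S : R -> X -> X) (w b : R -> R) (W Lf : R).
Hypothesis wK : convolution_like w (L1_norm k) (K_op k : (R -> X) -> R -> X).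
Hypothesis bS : convolution_like b W (op_conv S).
Hypothesis Lf0 : 0 <= Lf.
Implicit Types (f : R * (X * X) -> X) (u v : R -> X).

(** Lipschitz continuity uniformly in time, for the sum of the distances. *)
Definition lipschitz_param f : Prop := forall t (u v phi psi : X),
  nrm (f (t, (u, phi)) - f (t, (v, psi))) <= Lf * (nrm (u - v) + nrm (phi - psi)).

(** The nonlinearity evaluated along [u]. *)
Definition forcing f u (s : R) : X := f (s, (u s, K_op k u s)).

(** The operator whose bounded continuous fixed points are the bounded continuous
    mild solutions. *)
Definition mild_operator f u : R -> X := op_conv S (forcing f u).

Lemma conv_weight_ge0 (w' : R -> R) W' (J : (R -> X) -> R -> X) :
  convolution_like w' W' J -> 0 <= W'.
Proof.
move=> [_ w0 wW _]; rewrite -lee_fin; apply: le_trans wW.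
by apply: integral_ge0 => r _; rewrite lee_fin.
Qed.

Lemma forcing_bc f u : bounded_continuous f -> BC u -> BC (forcing f u).
Proof. by move=> bf bu; exact: (superposition_bc bf bu (conv_bc wK bu)). Qed.

Lemma mild_operator_bc f u : bounded_continuous f -> BC u -> BC (mild_operator f u).
Proof. by move=> bf bu; apply: (conv_bc bS); exact: forcing_bc. Qed.

Lemma mild_operator_lip f u v c : bounded_continuous f -> lipschitz_param f ->
  BC u -> BC v -> (forall t, nrm (u t - v t) <= c) ->
  forall t, nrm (mild_operator f u t - mild_operator f v t)
    <= W * Lf * (1 + L1_norm k) * c.
Proof.
move=> bf flip bu bv uvc t.
have -> : W * Lf * (1 + L1_norm k) * c = W * (Lf * ((1 + L1_norm k) * c)).
  by rewrite !mulrA.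
rewrite /mild_operator; apply: (conv_lip bS); [exact: forcing_bc|exact: forcing_bc|].
move=> s; apply: le_trans (flip _ _ _ _ _) _; rewrite ler_wpM2l//.
rewrite mulrDl mul1r; apply: lerD; first exact: uvc.
exact: (conv_lip wK s bu bv uvc).
Qed.

Lemma forcing_AA f u : AA_param f -> lipschitz_param f -> AA u -> AA (forcing f u).
Proof.
move=> fAA flip uAA.
exact: (superposition_AA Lf0 fAA flip uAA (conv_AA wK uAA)).
Qed.

Lemma forcing_C0 f f1 f2 u u1 : bounded_continuous f -> lipschitz_param f ->
  C0_param f2 -> (forall p, f p = f1 p + f2 p) -> BC u -> BC u1 ->
  nrm (u t - u1 t) @[t --> +oo] --> (0 : R) ->
  nrm (forcing f u t - forcing f1 u1 t) @[t --> +oo] --> (0 : R).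
Proof.
move=> bf flip f2C0 fE bu bu1 uu1.
have KK := conv_C0 wK bu bu1 uu1.
have h2 := superposition_C0 f2C0 bu1 (conv_bc wK bu1).
apply: (@squeeze_cvgr _ _ _ _ (cst 0) (fun t =>
  Lf * (nrm (u t - u1 t) + nrm (K_op k u t - K_op k u1 t))
  + nrm (f2 (t, (u1 t, K_op k u1 t))))).
- apply: nearW => t; rewrite nrm_ge0/=.
  apply: le_trans (nrm_dist _ (forcing f u1 t) _) _; apply: lerD; first exact: flip.
  by rewrite /forcing fE addrC addKr.
- exact: cvg_cst.
- have -> : (0 : R) = Lf * (0 + 0) + 0 by rewrite !addr0 mulr0.
  by apply: cvgD => //; apply: cvgM; [exact: cvg_cst|exact: cvgD].
Qed.

Lemma AA_cst (x : X) : AA (fun=> x).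
Proof.
split; first by split; [move=> ?; exact: cvg_cst|exists (nrm x)].
move=> s; exists id; split => //; exists (fun=> x) => t.
by split; exact: cvg_cst.
Qed.

Hypothesis L1 : W * Lf * (1 + L1_norm k) < 1.

Let L0 : 0 <= W * Lf * (1 + L1_norm k).
Proof.
rewrite !mulr_ge0//; first exact: conv_weight_ge0 bS.
by rewrite addr_ge0//; exact: conv_weight_ge0 wK.
Qed.

(** The almost automorphic part solves the problem for the almost automorphic
    part of the nonlinearity; the rest of the solution is obtained as a fixed
    point among the functions asymptotic to it. *)
Lemma mild_operator_fixpoint f : AAA_param f -> lipschitz_param f ->
  exists2 u, AAA u & forall t, mild_operator f u t = u t.
Proof.
move=> [bf [f1 [f2 [f1AA f2C0 fE]]]] flip.
have f1lip := AA_part_lipschitz f1AA f2C0 fE flip.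
have bf1 : bounded_continuous f1 by case: f1AA.
have [u1 u1AA u1E] : exists2 u, AA u & forall t, mild_operator f1 u t = u t.
  apply: (contraction_fixpoint L0 L1 (AA_cst 0)).
  - by move=> u uAA; apply: (conv_AA bS); exact: forcing_AA.
  - by move=> u [].
  - by move=> u v c [bu _] [bv _]; exact: mild_operator_lip.
  - exact: uniform_limit_AA.
have bu1 : BC u1 by case: u1AA.
have [u [bu uu1] uE] : exists2 u, BC u /\ nrm (u t - u1 t) @[t --> +oo] --> (0 : R)
    & forall t, mild_operator f u t = u t.
  apply: (contraction_fixpoint L0 L1 (u0 := u1)).
  - by split => //; under eq_fun do rewrite subrr nrm0; exact: cvg_cst.
  - move=> u [bu uu1]; split; first exact: mild_operator_bc.
    under eq_fun do rewrite -u1E.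
    apply: (conv_C0 bS); [exact: forcing_bc|exact: forcing_bc|].
    exact: forcing_C0 bf flip f2C0 fE bu bu1 uu1.
  - by move=> u [].
  - by move=> u v c [bu _] [bv _]; exact: mild_operator_lip.
  - exact: uniform_limit_C0.
exists u => //; split => //; exists u1, (fun t => u t - u1 t); split => //.
- split => //; split.
    by move=> t; apply: cvgB; [exact: bu.1|exact: bu1.1].
  have [_ [c uc]] := bu; have [_ [c' uc']] := bu1.
  by exists (c + c') => t; rewrite (le_trans (nrmD _ _))// nrmN lerD.
- by move=> t; rewrite addrC subrK.
Qed.

Lemma mild_operator_fixpoint_unique f u v : bounded_continuous f -> lipschitz_param f ->
  BC u -> BC v -> (forall t, mild_operator f u t = u t) ->
  (forall t, mild_operator f v t = v t) -> u = v.
Proof.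
move=> bf flip bu bv uE vE; set q := W * Lf * (1 + L1_norm k).
have [c uvc] : exists c, forall t, nrm (u t - v t) <= c.
  have [_ [c uc]] := bu; have [_ [c' vc]] := bv.
  by exists (c + c') => t; rewrite (le_trans (nrmD _ _))// nrmN lerD.
have uvq n t : nrm (u t - v t) <= q ^+ n * c.
  elim: n t => [|n IH] t; first by rewrite mul1r.
  by rewrite exprS -mulrA -(uE t) -(vE t); exact: mild_operator_lip.
have q0 : q ^+ n * c @[n --> \oo] --> (0 : R).
  rewrite -(mul0r c); apply: cvgM; last exact: cvg_cst.
  by apply: cvg_expr; rewrite ger0_norm.
apply/funext => t; apply/eqP; rewrite -subr_eq0; apply/eqP/nrm0_eq0.
apply/eqP; rewrite eq_le nrm_ge0 andbT -(cvg_lim _ q0)//.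
by apply: limr_ge; [exact: (cvgP _ q0)|exact: nearW].
Qed.

End FixedPointProblem.

Local Close Scope complex_scope.

Theorem theorem3p3 (R : realType) (X : completeNormedModType R[i])
    (alpha : R) (halpha1 : 1 < alpha) (halpha2 : alpha < 2)
    (k : R -> R[i]) (hk : L1_Rplus k)
    (D : set X) (A : X -> X) (omega theta M : R)
    (hD : dense D) (homega : omega < 0)
    (htheta0 : 0 <= theta) (htheta : theta < pi * (1 - alpha / 2))
    (hM : 0 < M) (hA : sectorial D A omega theta M)
    (f : R * (X * X) -> X) (hf : AAA_param f)
    (Lf : R) (hLf : 0 < Lf)
    (hlip : forall (t : R) (u v phi psi : X),
       nrm (f (t, (u, phi)) - f (t, (v, psi)))
       <= Lf * (nrm (u - v) + nrm (phi - psi)))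
    (eps phi : R) (hpath : hankel_path alpha omega theta eps phi)
    (hS : strongly_continuous_family (S_alpha alpha D A eps phi))
    (C : R) (hC : 0 < C)
    (hbound : forall t, 0 <= t -> forall x : X,
       nrm (S_alpha alpha D A eps phi t x)
       <= C * M / (1 + `|omega| * t `^ alpha) * nrm x)
    (hLambda : C * M * `|omega| `^ (- (1 / alpha)) * pi
               / (alpha * sin (pi / alpha))
               * Lf * (1 + L1_norm k) < 1) :
  exists! u : R -> X,
    AAA u /\ mild_solution (S_alpha alpha D A eps phi) f k u.
Proof.
have om0 : 0 < `|omega| by rewrite normr_gt0 lt_eqF.
have CM0 : 0 <= C * M by rewrite mulr_ge0 ?ltW.
pose b r := C * M * decay alpha `|omega| r.
pose W := C * M * (`|omega| `^ (- (1 / alpha)) * pi / (alpha * sin (pi / alpha))).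
have mb : measurable_fun (`[0, +oo[%classic : set (measurableTypeR R)) b.
  by apply: measurable_funM => //; exact: measurable_decay.
have bW : (\int[lebesgue_measure]_(r in `[0%R, +oo[) (b r)%:E <= W%:E)%E.
  under eq_integral do rewrite EFinM.
  rewrite ge0_integralZl//; last 2 first.
  - by apply/measurable_EFinP; exact: measurable_decay.
  - by move=> r _; rewrite lee_fin decay_ge0.
  by rewrite /W [leRHS]EFinM lee_wpmul2l ?lee_fin// integral_decay_le.
have b0 r : 0 <= b r by rewrite mulr_ge0// decay_ge0.
have bni r r' : 0 <= r -> r <= r' -> b r' <= b r.
  by move=> r0 rr'; rewrite ler_wpM2l// decay_nonincreasing.
pose S := S_alpha alpha D A eps phi.
have bS : convolution_like b W (op_conv S) by exact: convolution_like_op.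
have [w wK] := @convolution_like_K R X k hk.
have L1 : W * Lf * (1 + L1_norm k) < 1.
  by apply: le_lt_trans hLambda; rewrite /W !mulrA.
have bf : bounded_continuous f by case: hf.
have mildP u : AAA u -> mild_solution S f k u <-> forall t, mild_operator k S f u t = u t.
  move=> [bu _]; split => [hu t|uE t]; first by have [_ ->] := hu t.
  split; last by rewrite -uE.
  exact: (op_conv_integrable hS mb bW b0 bni hbound t (forcing_bc wK bf bu)).
have [u uAAA uE] := mild_operator_fixpoint wK bS (ltW hLf) L1 hf hlip.
exists u; split; first by split => //; exact/mildP.
move=> v [vAAA /(mildP v vAAA) vE].
by apply: (mild_operator_fixpoint_unique wK bS (ltW hLf) L1 bf hlip) => //;
  [case: uAAA|case: vAAA].
Qed.
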